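(* Let $\mathbb T=\mathbb R/\mathbb Z$ with Lebesgue measure $|\cdot|$. (1) For all $0<q\le p<2$, for every $0$-symmetric open set $E\subset\mathbb T$ with $|E|>0$ and every $\varepsilon>0$, there exists a positive definite trigonometric polynomial $f$ such that $$\int_{\mathbb T\setminus E}|f|^p\le \varepsilon\left(\int_{\mathbb T}|f|^q\right)^{p/q}.$$ (2) For every $p>0$ which is not an even integer, there exists $q(p)<p$ such that for every $q$ with $q(p)<q<p$, for every $0$-symmetric open set $E\subset\mathbb T$ with $|E|>0$ and every $\varepsilon>0$, there exists a positive definite trigonometric polynomial $f$ such that $$\int_{\mathbb T\setminus E}|f|^p\le \varepsilon\left(\int_{\mathbb T}|f|^q\right)^{p/q}.$$
   Context: $e_k(x)=e^{2\pi i kx}$. A positive definite trigonometric polynomial is a finite sum $\sum_{k\in H}a_k e_k$ with $H\subset\mathbb Z$ finite and all $a_k\ge 0$. A set $E\subset\mathbb T$ is $0$-symmetric if $E=-E$. *)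

(* Defs.v *)
From HB Require Import structures.
From mathcomp Require Import all_boot all_order all_algebra.
From mathcomp Require Import all_classical all_reals all_analysis.
Set Implicit Arguments. Unset Strict Implicit. Unset Printing Implicit Defensive.
Import Order.TTheory GRing.Theory Num.Theory.
Import numFieldNormedType.Exports.
Local Open Scope classical_set_scope.
Local Open Scope ring_scope.

(* The torus T = R/Z is modelled by 1-periodic objects on R, with the
   fundamental domain [0,1). *)

(* Positive definite trigonometric polynomial f = sum_{k in H} a_k e_k,
   e_k(x) = exp(2 pi i k x).  Real and imaginary parts, and modulus |f(x)|. *)
Definition tp_re (R : realType) (H : seq int) (a : int -> R) (x : R) : R :=
  \sum_(k <- H) a k * cos (2 * pi * k%:~R * x).
Definition tp_im (R : realType) (H : seq int) (a : int -> R) (x : R) : R :=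
  \sum_(k <- H) a k * sin (2 * pi * k%:~R * x).
Definition tp_abs (R : realType) (H : seq int) (a : int -> R) (x : R) : R :=
  Num.sqrt (tp_re H a x ^+ 2 + tp_im H a x ^+ 2).

Definition pos_def_tp (R : realType) (H : seq int) (a : int -> R) : Prop :=
  uniq H /\ (forall k, k \in H -> 0 <= a k) /\ (exists2 k, k \in H & 0 < a k).

Definition sym_open_torus (R : realType) (E : set R) : Prop :=
  open E /\ (forall x, E x <-> E (x + 1)) /\ (forall x, E x <-> E (- x)).

Definition torus_measure (R : realType) (E : set R) : \bar R :=
  (@lebesgue_measure R) (E `&` `[0, 1[).

Definition concentration (R : realType) (p q : R) : Prop :=
  forall E : set R, sym_open_torus E -> (0 < torus_measure E)%E ->
  forall eps : R, 0 < eps ->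
  exists (H : seq int) (a : int -> R), pos_def_tp H a /\
    Rintegral (@lebesgue_measure R) (`[0, 1[ `\` E)
              (fun x => powR (tp_abs H a x) p)
    <= eps * powR (Rintegral (@lebesgue_measure R) `[0, 1[
                     (fun x => powR (tp_abs H a x) q)) (p / q).

(* Main.v *)
(** Call [D] a majorant of [S] when the Fourier coefficients of [S] are real and
    bounded in absolute value by those of [D].  If the [p]-norm of some [D] is
    smaller than the [q]-norm of some [S] that it majorizes, then taking
    products of dilates [S (N_i x)] and [D (N_i x)] makes the ratio of the norms
    exponentially small.  Let [phi] be a high power of the Fejer-type polynomial
    [(1 + cos (2 pi x)) / 2], and [psi] the sum of its translates by two opposite
    points of [E].  As [2 phi] majorizes [psi], the polynomial
    [psi (x) S (L x) + 2 phi (x) D (L x)] is positive definite; its first term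
    lives on [E] and its second term is negligible.  It remains to violate the
    majorant property: for [p < 2] with [1 + a e_1 - a e_(-1)], whose modulus is
    at least 1, and for [p > 2] not an even integer with [1 + e_1 - s e_m], where
    the sign of the first variation in [s] is that of a product of factors
    [p / 2 - j]. *)

(* The obstacle is that off [E] the product built from [S] is controlled only by its sup norm
   [B ^ n], which may be far larger than its [q]-norm. Hence the power of [bump] must grow with [n]:
   its exponent is [K * n], with [K] fixed so that the smallness of [bump] off [E] beats [B] factor
   by factor. This in turn damps the main term near the chosen point by [tau ^ (K * n)]. As [K] is
   fixed, [tau] can be so close to 1 that part of the gain of each factor survives, and the dilation
   [L] depends on [tau] alone. All constants are thus fixed before [n] is chosen. The 0-symmetry of
   [E] enters because a single translate has complex coefficients, whereas the sum of two opposite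
   ones has real coefficients. Even integers [p] are excluded since there Parseval, applied to the
   power [p / 2], gives the majorant property. The threshold q(p) arises because above 2 the
   violation is obtained for [q = p] and extended by continuity. *)
From mathcomp Require Import all_boot all_order all_algebra.
From mathcomp Require Import all_classical all_reals all_analysis.
From mathcomp Require Import measurable_realfun ring lra.
From mathcomp Require Import complex.
Require Import Defs.
Set Implicit Arguments. Unset Strict Implicit. Unset Printing Implicit Defensive.
Import Order.TTheory GRing.Theory Num.Theory.
Import numFieldNormedType.Exports.
Local Open Scope classical_set_scope.
Local Open Scope ring_scope.

(** * Real powers *)

Section powR_inequalities.
Context {R : realType}.
Implicit Types a b c p q s t x y : R.

(** Combine exp u >= 1 + u at u = c ln t with ln t = - ln (1/t) >= 1 - 1/t. *)
Lemma powR_ge1B c t : 0 <= c -> 0 < t -> 1 + c * (1 - t^-1) <= t `^ c.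
Proof.
move=> c0 t0; rewrite /powR gt_eqF//.
apply: le_trans (expR_ge1Dx _); rewrite lerD2l ler_wpM2l//.
have := @le_ln1Dx R (t^-1 - 1); rewrite subrKC lnV ?posrE//.
have ti0 : 0 < t^-1 by rewrite invr_gt0.
by lra.
Qed.

(** Write t^c = t * t^(c-1) and apply [powR_ge1B] to the second factor. *)
Lemma powR_bernoulli_ge c t : 1 <= c -> 0 <= t -> 1 + c * (t - 1) <= t `^ c.
Proof.
move=> c1; rewrite le_eqVlt => /predU1P[<-|t0].
  by rewrite powR0; [lra|rewrite gt_eqF//; lra].
rewrite -mulr_powRB1 ?(ltW t0)//; last by lra.
have := @powR_ge1B (c - 1) t; rewrite subr_ge0 => /(_ c1 t0).
rewrite -(ler_pM2l t0) => h.
apply: le_trans h.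
have -> : t * (1 + (c - 1) * (1 - t^-1)) = 1 + c * (t - 1) by field; rewrite gt_eqF.
by [].
Qed.

(** This is the convex case for the exponent 1/c at the point t^c. *)
Lemma powR_bernoulli_le c t : 0 <= c <= 1 -> 0 <= t -> t `^ c <= 1 + c * (t - 1).
Proof.
move=> /andP[]; rewrite le_eqVlt => /predU1P[<- _ _|c0 c1 t0].
  by rewrite powRr0; lra.
have := @powR_bernoulli_ge c^-1 (t `^ c).
rewrite invf_ge1// => /(_ c1 (powR_ge0 _ _)).
rewrite -powRrM mulfV ?gt_eqF// powRr1// -(ler_pM2l c0).
by rewrite mulrDr mulr1 mulVKf ?gt_eqF//; lra.
Qed.

(** The convex function t^c lies above its tangent at x; this is Bernoulli's inequality at y / x. It
    later replaces differentiation under the integral sign. *)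
Lemma powR_subl_le c x y : 1 < c -> 0 <= x -> 0 <= y ->
  x `^ c - y `^ c <= c * x `^ (c - 1) * (x - y).
Proof.
move=> c1; have cn0 : c != 0 by rewrite gt_eqF//; lra.
rewrite le_eqVlt => /predU1P[<-|x0] y0.
  have c10 : c - 1 != 0 by rewrite gt_eqF// subr_gt0.
  by rewrite !powR0// mulr0 mul0r; have := powR_ge0 y c; lra.
have := @powR_bernoulli_ge c (y / x) (ltW c1).
rewrite (divr_ge0 y0 (ltW x0)) => /(_ isT).
have xc : 0 < x `^ c by exact: powR_gt0.
rewrite powRM ?invr_ge0 ?(ltW x0)// -(ler_pM2l xc).
have -> : x^-1 `^ c = (x `^ c)^-1.
  by rewrite -(@powR_inv1 _ x) ?(ltW x0)// -powRrM mulN1r powRN.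
rewrite [_ * (y `^ c / _)]mulrC mulfVK ?gt_eqF//.
have -> : x `^ c * (1 + c * (y / x - 1)) = x `^ c - c * x `^ (c - 1) * (x - y).
  rewrite -(@mulr_powRB1 _ x c) ?(ltW x0)//; last by lra.
  by field; rewrite gt_eqF.
by lra.
Qed.

Lemma powRD_le c x y : 0 < c -> 0 <= x -> 0 <= y ->
  (x + y) `^ c <= 2 `^ c * (x `^ c + y `^ c).
Proof.
move=> c0; wlog xy : x y / x <= y.
  move=> h x0 y0; case: (leP x y) => [|/ltW] xy; first exact: h.
  by rewrite addrC [X in _ * X]addrC; exact: h.
move=> x0 y0; apply: (@le_trans _ _ ((2 * y) `^ c)).
  by rewrite ge0_ler_powR ?nnegrE ?(ltW c0)//; lra.
by rewrite powRM// ler_wpM2l ?powR_ge0// lerDr powR_ge0.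
Qed.

(** The absolute value keeps [powR] away from its default values at negative reals. The point 0,
    where differentiability may fail, is treated by hand. *)
Lemma continuous_normr_powR c : 0 < c -> continuous (fun t : R => `|t| `^ c).
Proof.
move=> c0 t; have [->|t0] := eqVneq t 0.
  rewrite /continuous_at normr0 powR0 ?gt_eqF//.
  apply/cvgrPdist_lt => e e0; near=> s.
  rewrite sub0r normrN ger0_norm ?powR_ge0//.
  have -> : e = (e `^ c^-1) `^ c by rewrite -powRrM mulVf ?gt_eqF// powRr1// ltW.
  rewrite gt0_ltr_powR ?nnegrE ?powR_ge0//.
  by near: s; apply: cvgr0_norm_lt => //; rewrite powR_gt0.
apply: (@continuous_comp _ _ _ (fun t : R => `|t|) (fun t => t `^ c)).
  exact: norm_continuous.
apply/differentiable_continuous/derivable1_diffP/derivable_powR.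
by rewrite in_itv/= andbT normr_gt0.
Unshelve. all: by end_near. Qed.

Lemma continuous_powR_comp c (g : R -> R) : 0 < c -> continuous g ->
  (forall x, 0 <= g x) -> continuous (fun x => g x `^ c).
Proof.
move=> c0 cg g0 x.
have -> : (fun x => g x `^ c) = (fun t : R => `|t| `^ c) \o g.
  by apply/funext => y /=; rewrite ger0_norm.
by apply: continuous_comp; [exact: cg|exact: continuous_normr_powR].
Qed.

(** Only [x] is confined to the segment: [y] may leave it. Each [x] contributes a ball of half its
    continuity radius, and compactness makes finitely many of them suffice. *)
Lemma segment_unif_continuous (f : R -> R) (a b e : R) : continuous f -> 0 < e ->
  exists2 d : R, 0 < d &
    forall x y : R, a <= x <= b -> `|x - y| < d -> `|f x - f y| < e.
Proof.
move=> cf e0.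
have /compact_near_coveringP cov := @segment_compact R a b.
have := cov R 0^'+
  (fun d x => forall y : R, `|x - y| < d -> `|f x - f y| < e) _.
case=> [x _|d /= d0 dP].
  have /cvgrPdist_lt/(_ (e / 2)) := cf x.
  rewrite divr_gt0// => /(_ isT)[r /= r0 rP].
  exists (ball x (r / 2), [set d | d < r / 2]) => /=.
    split; first by apply: nbhsx_ballx; rewrite divr_gt0.
    by apply: nbhs_right_lt; rewrite divr_gt0.
  move=> [z d] /= [zx dr] y zy.
  have xz : `|x - z| < r / 2 by [].
  have h1 : `|f x - f z| < e / 2.
    by apply: rP => /=; apply: lt_trans xz _; rewrite ltr_pdivrMr// ltr_pMr// ltr1n.
  have h2 : `|f x - f y| < e / 2.
    apply: rP => /=; apply: le_lt_trans (ler_distD z _ _) _.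
    by rewrite [r in _ < r]splitr ltrD// (lt_trans zy).
  apply: le_lt_trans (ler_distD (f x) _ _) _.
  by rewrite distrC [e in _ < e]splitr ltrD.
exists (d / 2); first by rewrite divr_gt0.
move=> x y xab xy; apply: (dP (d / 2)) => //=.
- by rewrite sub0r normrN gtr0_norm ?divr_gt0// ltr_pdivrMr// ltr_pMr// ltr1n.
- by rewrite divr_gt0.
Qed.

End powR_inequalities.

(** * Integrals of continuous periodic functions *)

Section continuous_integral.
Context {R : realType}.
Implicit Types (a b c k x y : R) (f g h : R -> R).

Definition integ a b f : R := Rintegral (@lebesgue_measure R) `[a, b] f.

Lemma integrable_itv a b h : continuous h ->
  (@lebesgue_measure R).-integrable `[a, b] (EFin \o h).
Proof.
move=> ch; apply: continuous_compact_integrable; first exact: segment_compact.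
by apply: continuous_subspaceT.
Qed.

Lemma integ_bndo a b h : continuous h ->
  Rintegral (@lebesgue_measure R) `[a, b[ h = integ a b h.
Proof.
move=> ch; rewrite /integ Rintegral_itv_bndo_bndc//.
apply: integrableS (@integrable_itv a b h ch) => //.
by apply: subset_itvl; rewrite bnd_simp.
Qed.

Lemma eq_integ a b f g : f =1 g -> integ a b f = integ a b g.
Proof. by move=> fg; congr integ; exact/funext. Qed.

Lemma integD a b f g : continuous f -> continuous g ->
  integ a b (fun x => f x + g x) = integ a b f + integ a b g.
Proof. by move=> cf cg; apply: RintegralD => //; exact: integrable_itv. Qed.

Lemma integB a b f g : continuous f -> continuous g ->
  integ a b (fun x => f x - g x) = integ a b f - integ a b g.
Proof. by move=> cf cg; apply: RintegralB => //; exact: integrable_itv. Qed.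

Lemma integZ a b k f : continuous f ->
  integ a b (fun x => k * f x) = k * integ a b f.
Proof. by move=> cf; apply: RintegralZl => //; exact: integrable_itv. Qed.

Lemma integ_cst a b k : a <= b -> integ a b (fun=> k) = k * (b - a).
Proof.
move=> ab; rewrite /integ.
have := @Rintegral_cst _ _ R (@lebesgue_measure R) `[a, b] (measurable_itv _) k.
rewrite /cst/= => ->.
rewrite lebesgue_measure_itv/= lte_fin; case: ltP => //= ba.
by have -> : a = b; [apply/le_anti/andP|rewrite subrr].
Qed.

Lemma le_integ a b f g : continuous f -> continuous g ->
  (forall x, a <= x <= b -> f x <= g x) -> integ a b f <= integ a b g.
Proof.
move=> cf cg fg; apply: le_Rintegral; [by []|exact: integrable_itv..|].
by move=> x /=; rewrite in_itv/= => ?; exact: fg.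
Qed.

Lemma integ_ge0 a b f : (forall x, 0 <= f x) -> 0 <= integ a b f.
Proof. by move=> f0; apply: Rintegral_ge0 => x _. Qed.

Lemma integ_split b a c h : a <= b -> b <= c -> continuous h ->
  integ a c h = integ a b h + integ b c h.
Proof.
move=> ab bc ch.
have := @Rintegral_itvB R h (BLeft a) (BRight c) b (integrable_itv _ _ ch).
rewrite !bnd_simp => /(_ ab bc); rewrite Rintegral_itv_obnd_cbnd; last first.
  apply: integrableS (@integrable_itv b c h ch) => //.
  by apply: subset_itvr; rewrite bnd_simp.
by rewrite /integ => <-; rewrite subrKC.
Qed.

Lemma integ_le_sub a b c d h : continuous h -> (forall x, 0 <= h x) ->
  c <= a -> a <= b -> b <= d -> integ a b h <= integ c d h.
Proof.
move=> ch h0 ca ab bd; rewrite (@integ_split a c d)//; last exact: le_trans bd.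
rewrite (@integ_split b a d)//.
have := integ_ge0 c a h0; have := integ_ge0 b d h0; lra.
Qed.

Lemma integ_affine a b k c h : a <= b -> 0 < k -> continuous h ->
  integ (k * a + c) (k * b + c) h = k * integ a b (fun x => h (k * x + c)).
Proof.
move=> ab k0 ch; pose F x := k * x + c.
have dF x : is_derive x 1 F k.
  have -> : F = (k \*: (@id R)) + cst c by [].
  by apply: is_derive_eq; rewrite addr0 /GRing.scale/= mulr1.
have F'E : F^`()%classic = cst k.
  by apply/funext => x; rewrite derive1E; apply: derive_val.
have cF : continuous F.
  move=> x; apply/differentiable_continuous/derivable1_diffP.
  by have [] := dF x.
have cC : continuous (fun x => h (k * x + c)).
  by move=> x; apply: (@continuous_comp _ _ _ F h); [exact: cF|exact: ch].
rewrite -integZ// /integ /Rintegral; congr fine.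
have := @integration_by_substitution_increasing R F h a b ab.
rewrite F'E /F => -> //.
- by apply: eq_integral => x _ /=; rewrite mulrC.
- by move=> x y _ _ xy; rewrite ltrD2r ltr_pM2l.
- by move=> x _; exact: cst_continuous.
- exact: is_cvg_cst.
- exact: is_cvg_cst.
- split.
  + by move=> x _; have [] := dF x.
  + by apply: cvg_at_right_filter; exact: cF.
  + by apply: cvg_at_left_filter; exact: cF.
- exact: continuous_subspaceT.
Qed.

Definition periodic1 {T : Type} (h : R -> T) := forall x, h (x + 1) = h x.

Lemma periodic1_nat (T : Type) (h : R -> T) (n : nat) x :
  periodic1 h -> h (x + n%:R) = h x.
Proof.
by move=> ph; elim: n => [|n IH]; rewrite ?addr0// -natr1 addrA ph.
Qed.

Lemma periodic1_int (T : Type) (h : R -> T) (n : int) x :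
  periodic1 h -> h (x + n%:~R) = h x.
Proof.
move=> ph; case: n => n; first exact: periodic1_nat.
by rewrite NegzE mulrNz -(@periodic1_nat _ h n.+1) ?subrK.
Qed.

Lemma integ_shift a b c h : a <= b -> continuous h ->
  integ (a + c) (b + c) h = integ a b (fun x => h (x + c)).
Proof.
move=> ab ch; have := @integ_affine a b 1 c h ab ltr01 ch.
by rewrite !mul1r => ->; apply: eq_integ => x; rewrite mul1r.
Qed.

(** Reduce [a] modulo 1 to some t in [0, 1], split [t, t + 1] at 1, and move the piece [1, t + 1]
    back to [0, t]. *)
Lemma integ_period a h : continuous h -> periodic1 h ->
  integ a (a + 1) h = integ 0 1 h.
Proof.
move=> ch ph.
have shiftn t u (n : int) : t <= u -> integ (t + n%:~R) (u + n%:~R) h = integ t u h.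
  by move=> tu; rewrite integ_shift//; apply: eq_integ => x; rewrite periodic1_int.
have /andP[] := floor_itv a; set n := Num.floor a => na an.
pose t := a - n%:~R.
have t0 : 0 <= t by rewrite subr_ge0.
have t1 : t <= 1 by rewrite /t; move: an; rewrite intrD; lra.
have -> : a = t + n%:~R by rewrite /t subrK.
rewrite (addrAC t n%:~R 1) shiftn; last by rewrite lerDl.
rewrite (@integ_split 1)//; last by rewrite lerDr.
rewrite [RHS](@integ_split t)//.
by have := @shiftn 0 t 1 t0; rewrite add0r mulr1z => ->; rewrite addrC.
Qed.

Lemma integ_period_nat (n : nat) h : continuous h -> periodic1 h ->
  integ 0 n%:R h = n%:R * integ 0 1 h.
Proof.
move=> ch ph; elim: n => [|n IH].
  rewrite mul0r /integ set_itv1 Rintegral_set1//.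
rewrite -natr1 (@integ_split n%:R)//; last by rewrite lerDl.
by rewrite IH integ_period// mulrDl mul1r.
Qed.

Lemma continuous_dilation k (T : topologicalType) (h : R -> T) :
  continuous h -> continuous (fun x => h (k * x)).
Proof.
move=> ch x; apply: (@continuous_comp _ _ _ ( *%R k) h); last exact: ch.
exact: mulrl_continuous.
Qed.

(** A cell of length 1/L carries exactly one period of h (L x), wherever it starts. *)
Lemma integ_dilation_cell (L : nat) a h : (0 < L)%N ->
  continuous h -> periodic1 h ->
  integ a (a + L%:R^-1) (fun x => h (L%:R * x)) = L%:R^-1 * integ 0 1 h.
Proof.
move=> L0 ch ph; have Lp : 0 < (L%:R : R) by rewrite ltr0n.
have := @integ_affine a (a + L%:R^-1) L%:R 0 h _ Lp ch.
rewrite lerDl invr_ge0 ltW// => /(_ isT).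
rewrite !addr0 mulrDr mulfV ?gt_eqF// integ_period// => ->.
rewrite mulKf ?gt_eqF//.
by apply: eq_integ => x; rewrite addr0.
Qed.

Lemma integ_dilation (L : nat) h : (0 < L)%N -> continuous h -> periodic1 h ->
  integ 0 1 (fun x => h (L%:R * x)) = integ 0 1 h.
Proof.
move=> L0 ch ph; have Lp : 0 < (L%:R : R) by rewrite ltr0n.
have := @integ_affine 0 1 L%:R 0 h ler01 Lp ch.
rewrite !addr0 mulr0 mulr1 integ_period_nat// => /mulfI->; last by rewrite gt_eqF.
by apply: eq_integ => x; rewrite addr0.
Qed.

End continuous_integral.

(** * Fejer's lemma: asymptotic independence of f (x) and g (N x) *)

Section fejer.
Context {R : realType}.
Implicit Types (a b c k w x y : R) (f g h : R -> R).

Lemma continuous_const c : continuous (fun _ : R => c).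
Proof. by move=> x; exact: cst_continuous. Qed.
Arguments continuous_const : clear implicits.
#[local] Hint Extern 0 (continuous _) => exact: continuous_const : core.

Lemma continuousM_fun f g :
  continuous f -> continuous g -> continuous (fun x => f x * g x).
Proof. by move=> cf cg x; apply: cvgM; [exact: cf|exact: cg]. Qed.

Lemma continuousZ_fun c f : continuous f -> continuous (fun x => c * f x).
Proof. by move=> cf; exact: (continuousM_fun (continuous_const c) cf). Qed.

(** Here [w] bounds the oscillation of [f] on one cell, so [f] exceeds its mean there by at most
    [w], and the integral of g (N x) over the cell is known exactly. *)
Let fejer_cell (N : nat) a w f g : (0 < N)%N -> continuous f ->
  continuous g -> periodic1 g -> (forall x, 0 <= g x) ->
  (forall x y, a <= x <= a + N%:R^-1 -> a <= y <= a + N%:R^-1 ->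
    f x <= f y + w) ->
  integ a (a + N%:R^-1) (fun x => f x * g (N%:R * x)) <=
  (integ a (a + N%:R^-1) f + w * N%:R^-1) * integ 0 1 g.
Proof.
move=> N0 cf cg pg g0 fw; have Np : 0 < (N%:R : R) by rewrite ltr0n.
have Ni : 0 < (N%:R^-1 : R) by rewrite invr_gt0.
set b := a + _; have ab : a <= b by rewrite lerDl ltW.
set J := integ a b f.
have gN : continuous (fun x => g (N%:R * x)) by exact: continuous_dilation.
(* Average f x <= f y + w over all y of the cell. *)
have fJ x : a <= x <= b -> f x <= N%:R * J + w.
  move=> xab.
  have : integ a b (fun=> f x) <= integ a b (fun y => f y + w).
    apply: le_integ => //.
      by move=> y; apply: cvgD; [exact: cf|exact: continuous_const].
    by move=> y yab; exact: fw.
  rewrite integD// !integ_cst// -/J /b addrC addKr.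
  rewrite -(ler_pM2l Np) mulrDr !(mulrCA N%:R) mulfV ?gt_eqF// !mulr1.
  by [].
have -> : (J + w * N%:R^-1) * integ 0 1 g =
    integ a b (fun x => (N%:R * J + w) * g (N%:R * x)).
  rewrite integZ// integ_dilation_cell//; field.
  by rewrite gt_eqF.
apply: le_integ; [exact: continuousM_fun|exact: continuousM_fun|].
by move=> x xab; rewrite ler_wpM2r// fJ.
Qed.

Let fejer_upper (N : nat) w f g : (0 < N)%N -> continuous f ->
  continuous g -> periodic1 g -> (forall x, 0 <= g x) ->
  (forall x y, 0 <= x <= 1 -> `|x - y| <= N%:R^-1 -> f x <= f y + w) ->
  integ 0 1 (fun x => f x * g (N%:R * x)) <= (integ 0 1 f + w) * integ 0 1 g.
Proof.
move=> N0 cf cg pg g0 fw; have Np : 0 < (N%:R : R) by rewrite ltr0n.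
have Ni : 0 < (N%:R^-1 : R) by rewrite invr_gt0.
have cfg : continuous (fun x => f x * g (N%:R * x)).
  by apply: continuousM_fun => //; exact: continuous_dilation.
suff H j : (j <= N)%N -> integ 0 (j%:R / N%:R) (fun x => f x * g (N%:R * x)) <=
    (integ 0 (j%:R / N%:R) f + w * (j%:R / N%:R)) * integ 0 1 g.
  by have := H N (leqnn _); rewrite mulfV ?gt_eqF// mulr1.
elim: j => [_|j IH jN].
  by rewrite mul0r mulr0 addr0 /integ set_itv1 !Rintegral_set1 mul0r.
have jE : (j.+1%:R / N%:R : R) = j%:R / N%:R + N%:R^-1.
  by rewrite -natr1 mulrDl mul1r.
have j0 : 0 <= (j%:R / N%:R : R) by rewrite divr_ge0.
have j1 : (j%:R / N%:R + N%:R^-1 : R) <= 1.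
  by rewrite -jE ler_pdivrMr// mul1r ler_nat.
rewrite jE.
have sp h : continuous h -> integ 0 (j%:R / N%:R + N%:R^-1) h =
    integ 0 (j%:R / N%:R) h + integ (j%:R / N%:R) (j%:R / N%:R + N%:R^-1) h.
  by move=> ch; rewrite -integ_split// lerDl ltW.
rewrite (sp _ cf) (sp _ cfg).
have := IH (ltnW jN).
have := @fejer_cell N (j%:R / N%:R) w f g N0 cf cg pg g0.
have h x y : j%:R / N%:R <= x <= j%:R / N%:R + N%:R^-1 ->
    j%:R / N%:R <= y <= j%:R / N%:R + N%:R^-1 -> f x <= f y + w.
  by move=> hx hy; apply: fw; [lra|rewrite ler_norml; lra].
by move=> /(_ h); lra.
Qed.

(** The lower bound is the upper bound for [- f]; only [g] has to be nonnegative. *)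
Lemma fejer f g w : continuous f -> continuous g -> periodic1 g ->
  (forall x, 0 <= g x) -> 0 < w ->
  exists N0 : nat, forall N : nat, (N0 <= N)%N -> (0 < N)%N ->
    (integ 0 1 f - w) * integ 0 1 g <= integ 0 1 (fun x => f x * g (N%:R * x))
      <= (integ 0 1 f + w) * integ 0 1 g.
Proof.
move=> cf cg pg g0 w0.
have [d d0 dP] := @segment_unif_continuous R f 0 1 w cf w0.
exists (Num.truncn d^-1).+1 => N N0N N0.
have Np : 0 < (N%:R : R) by rewrite ltr0n.
have Nd : (N%:R^-1 : R) < d.
  rewrite invf_plt ?posrE// (lt_le_trans (truncnS_gt _))//.
  by rewrite ler_nat.
have cfN : continuous (fun x => - f x) by move=> x; apply: cvgN; exact: cf.
have gN : continuous (fun x => g (N%:R * x)) by exact: continuous_dilation.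
apply/andP; split.
  have := @fejer_upper N w (fun x => - f x) g N0 cfN cg pg g0.
  have -> : integ 0 1 (fun x => - f x) = - integ 0 1 f.
    by rewrite -mulN1r -integZ//; apply: eq_integ => x; rewrite mulN1r.
  have -> : integ 0 1 (fun x => - f x * g (N%:R * x)) =
      - integ 0 1 (fun x => f x * g (N%:R * x)).
    rewrite -mulN1r -integZ//; last exact: continuousM_fun.
    by apply: eq_integ => x; rewrite mulN1r mulNr.
  have h x y : 0 <= x <= 1 -> `|x - y| <= N%:R^-1 -> - f x <= - f y + w.
    move=> x01 xy; have := dP x y x01 (le_lt_trans xy Nd).
    by rewrite ltr_norml; lra.
  by move=> /(_ h); lra.
apply: fejer_upper => // x y x01 xy.
have := dP x y x01 (le_lt_trans xy Nd).
by rewrite ltr_norml; lra.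
Qed.

End fejer.
Arguments continuous_const {R}.
Arguments continuousZ_fun {R} c [f].

#[local] Hint Extern 0 (continuous _) => exact: continuous_const : core.

(** * Positive definite trigonometric polynomials *)

Import ComplexField.Normc.
Local Open Scope complex_scope.

Local Notation Re := complex.Re.
Local Notation Im := complex.Im.

Section complex_functions.
Context {R : realType}.
Implicit Types (z w : R[i]) (f g S D : R -> R[i]) (x y c : R).

Lemma ReD z w : Re (z + w) = Re z + Re w.
Proof. by case: z => a b; case: w => c d. Qed.
Lemma ImD z w : Im (z + w) = Im z + Im w.
Proof. by case: z => a b; case: w => c d. Qed.
Lemma ReM z w : Re (z * w) = Re z * Re w - Im z * Im w.
Proof. by case: z => a b; case: w => c d. Qed.
Lemma ImM z w : Im (z * w) = Re z * Im w + Im z * Re w.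
Proof. by case: z => a b; case: w => c d /=. Qed.

Lemma normcE_ReIm z : normc z = Num.sqrt (Re z ^+ 2 + Im z ^+ 2).
Proof. by case: z. Qed.
Lemma normc_ge0 z : 0 <= normc z.
Proof. by rewrite normcE_ReIm sqrtr_ge0. Qed.
Lemma normc_leD z w : normc (z + w) <= normc z + normc w.
Proof. exact: le_normcD. Qed.
Lemma normc_real c : normc c%:C = `|c|.
Proof. by rewrite normcE_ReIm /= expr0n/= addr0 sqrtr_sqr. Qed.

(** Continuity is asked of the real and imaginary parts, so that only the topology of the reals
    intervenes. *)
Definition regular f :=
  [/\ continuous (fun x => Re (f x)), continuous (fun x => Im (f x)) &
      periodic1 f].

Lemma eq_regular f g : f =1 g -> regular f -> regular g.
Proof. by move=> /funext ->. Qed.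

Lemma regular_cst z : regular (fun=> z).
Proof. by split => // x; exact: cst_continuous. Qed.

Lemma regularD f g : regular f -> regular g -> regular (fun x => f x + g x).
Proof.
move=> [rf jf pf] [rg jg pg]; split.
- under [X in continuous X]funext do rewrite ReD.
  by move=> x; apply: cvgD; [exact: rf|exact: rg].
- under [X in continuous X]funext do rewrite ImD.
  by move=> x; apply: cvgD; [exact: jf|exact: jg].
- by move=> x; rewrite pf pg.
Qed.

Lemma regularM f g : regular f -> regular g -> regular (fun x => f x * g x).
Proof.
move=> [rf jf pf] [rg jg pg]; split.
- under [X in continuous X]funext do rewrite ReM.
  move=> x; apply: cvgB; apply: cvgM;
    [exact: rf|exact: rg|exact: jf|exact: jg].
- under [X in continuous X]funext do rewrite ImM.
  move=> x; apply: cvgD; apply: cvgM;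
    [exact: rf|exact: jg|exact: jf|exact: rg].
- by move=> x; rewrite pf pg.
Qed.

Lemma regular_dilation (n : nat) f :
  regular f -> regular (fun x => f (n%:R * x)).
Proof.
move=> [rf jf pf]; split.
- exact: (@continuous_dilation R n%:R _ (fun x => Re (f x))).
- exact: (@continuous_dilation R n%:R _ (fun x => Im (f x))).
- by move=> x; rewrite mulrDr mulr1 periodic1_nat.
Qed.

Lemma continuous_normc f : regular f -> continuous (fun x => normc (f x)).
Proof.
move=> [rf jf _].
under [X in continuous X]funext do rewrite normcE_ReIm.
move=> x; apply: (@continuous_comp _ _ _
  (fun x => Re (f x) ^+ 2 + Im (f x) ^+ 2) Num.sqrt); last exact: sqrt_continuous.
by apply: cvgD; apply: cvgM; [exact: rf..|exact: jf|exact: jf].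
Qed.

Lemma continuous_normc_powR f c : 0 < c -> regular f ->
  continuous (fun x => normc (f x) `^ c).
Proof.
move=> c0 rf; apply: continuous_powR_comp => //; first exact: continuous_normc.
by move=> x; exact: normc_ge0.
Qed.

Lemma periodic1_normc_powR f c : regular f ->
  periodic1 (fun x => normc (f x) `^ c).
Proof. by move=> [_ _ pf] x; rewrite pf. Qed.

Definition ek (k : int) x : R[i] :=
  cos (2 * pi * k%:~R * x) +i* sin (2 * pi * k%:~R * x).

Lemma ekD k l x : ek (k + l) x = ek k x * ek l x.
Proof.
rewrite /ek intrD mulrDr mulrDl cosD sinD.
by apply/eqP; rewrite eq_complex /= eqxx/= [X in X == _]addrC.
Qed.

Lemma ek0 x : ek 0 x = 1.
Proof. by rewrite /ek mulr0 mul0r cos0 sin0. Qed.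

Lemma ek_dilation (n : nat) k x : ek k (n%:R * x) = ek (n%:Z * k) x.
Proof.
by rewrite /ek intrM -pmulrn [in RHS]mulrA [in RHS](mulrAC _ n%:R) -!mulrA.
Qed.

Lemma ek_period k : periodic1 (ek k).
Proof.
move=> x; rewrite /ek mulrDr mulr1.
have per (h : R -> R) t (n : int) : periodic h (pi *+ 2) ->
    h (t + 2 * pi * n%:~R) = h t.
  move=> ph; case: n => n.
    by rewrite -pmulrn mulr_natr mulr_natl; exact: periodicn.
  rewrite NegzE mulrNz -(periodicn ph n.+1).
  by congr h; rewrite -pmulrn mulrN mulr_natr mulr_natl subrK.
by rewrite (per cos) ?(per sin)//; [exact: sinD2pi|exact: cosD2pi].
Qed.

Lemma regular_ek k : regular (ek k).
Proof.
split; last exact: ek_period.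
- by apply: (@continuous_dilation R _ _ cos); exact: continuous_cos.
- by apply: (@continuous_dilation R _ _ sin); exact: continuous_sin.
Qed.

Definition tpoly (s : seq (R * int)) x : R[i] := \sum_(t <- s) t.1%:C * ek t.2 x.

(** The list may repeat frequencies: sums and products are then concatenations and lists of pairs,
    and equal frequencies are merged only once, in [pos_def_tp_of_posdef]. *)
Definition posdef f :=
  exists2 s : seq (R * int), all (fun t => 0 <= t.1) s & f =1 tpoly s.

Lemma eq_posdef f g : f =1 g -> posdef f -> posdef g.
Proof. by move=> /funext ->. Qed.

Lemma posdef_ek c k : 0 <= c -> posdef (fun x => c%:C * ek k x).
Proof.
by move=> c0; exists [:: (c, k)] => [|x]; rewrite /= ?c0// /tpoly big_seq1.
Qed.

Lemma posdef_cst c : 0 <= c -> posdef (fun=> c%:C).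
Proof.
by move=> /(@posdef_ek _ 0); apply: eq_posdef => x; rewrite ek0 mulr1.
Qed.

Lemma posdefD f g : posdef f -> posdef g -> posdef (fun x => f x + g x).
Proof.
move=> [s s0 fs] [t t0 gt]; exists (s ++ t); first by rewrite all_cat s0.
by move=> x; rewrite /tpoly big_cat fs gt.
Qed.

Lemma posdefM f g : posdef f -> posdef g -> posdef (fun x => f x * g x).
Proof.
move=> [s s0 fs] [t t0 gt].
exists [seq (u.1 * v.1, u.2 + v.2) | u <- s, v <- t].
  apply/all_allpairsP => u v us vt /=.
  by apply: mulr_ge0; [exact: (allP s0 u us)|exact: (allP t0 v vt)].
move=> x; rewrite fs gt /tpoly big_allpairs_dep mulr_suml.
apply: eq_bigr => u _; rewrite mulr_sumr; apply: eq_bigr => v _ /=.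
by rewrite ekD rmorphM/= mulrACA.
Qed.

Lemma posdefX f n : posdef f -> posdef (fun x => f x ^+ n).
Proof.
move=> pf; elim: n => [|n IH].
  by apply: eq_posdef (posdef_cst ler01) => x; rewrite expr0.
by apply: eq_posdef (posdefM pf IH) => x; rewrite exprS.
Qed.

Lemma posdef_dilation (n : nat) f :
  posdef f -> posdef (fun x => f (n%:R * x)).
Proof.
move=> [s s0 fs]; exists [seq (t.1, n%:Z * t.2) | t <- s].
  by rewrite all_map; apply: sub_all s0.
move=> x; rewrite fs /tpoly big_map; apply: eq_bigr => t _ /=.
by rewrite ek_dilation.
Qed.

Lemma regular_posdef f : posdef f -> regular f.
Proof.
move=> [s _ fs]; apply: (@eq_regular (tpoly s)) => //.
rewrite /tpoly; elim: s {fs} => [|t s IH].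
  by apply: eq_regular (regular_cst 0) => x; rewrite big_nil.
apply: (@eq_regular (fun x => t.1%:C * ek t.2 x + tpoly s x)).
  by move=> x; rewrite big_cons.
by apply: regularD => //; apply: regularM;
  [exact: regular_cst|exact: regular_ek].
Qed.

(** Coefficients of equal frequencies are added up. The nonzero value at [x0] supplies the positive
    coefficient that [pos_def_tp] demands: if all vanished, so would [f]. *)
Lemma pos_def_tp_of_posdef f x0 : posdef f -> f x0 != 0 ->
  exists (H : seq int) (a : int -> R), pos_def_tp H a /\
    forall x, tp_abs H a x = normc (f x).
Proof.
move=> [s s0 fs] fx0.
pose H := undup [seq t.2 | t <- s].
pose a k := \sum_(t <- s | t.2 == k) t.1.
have a0 k : 0 <= a k.
  by rewrite /a big_seq_cond sumr_ge0// => t /andP[/(allP s0)].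
have collect (u : int -> R) : \sum_(k <- H) a k * u k = \sum_(t <- s) t.1 * u t.2.
  rewrite /a; under eq_bigr do rewrite mulr_suml.
  rewrite (exchange_big_dep predT)//= [RHS]big_seq [LHS]big_seq.
  apply: eq_bigr => t ts; rewrite big_mkcond.
  rewrite (bigD1_seq t.2)/= ?undup_uniq ?mem_undup ?map_f//.
  by rewrite eqxx big1 ?addr0// => k; rewrite eq_sym => /negbTE ->.
have Retp x : Re (f x) = tp_re H a x.
  rewrite fs /tpoly /tp_re (collect (fun k => cos (2 * pi * k%:~R * x))).
  by elim/big_ind2: _ => //= [u v z w <- <-|t _]; rewrite ?ReD// mul0r subr0.
have Imtp x : Im (f x) = tp_im H a x.
  rewrite fs /tpoly /tp_im (collect (fun k => sin (2 * pi * k%:~R * x))).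
  by elim/big_ind2: _ => //= [u v z w <- <-|t _]; rewrite ?ImD// mul0r addr0.
exists H, a; split; last by move=> x; rewrite normcE_ReIm Retp Imtp.
split; [exact: undup_uniq|split => // ].
apply: contrapT => nex; move/negP: fx0; apply.
have ak0 k : k \in H -> a k = 0.
  move=> kH; apply/le_anti; rewrite a0 andbT leNgt.
  by apply/negP => ak; apply: nex; exists k.
rewrite eq_complex Retp Imtp /tp_re /tp_im.
by rewrite !big_seq !big1 ?eqxx// => k /ak0 ->; rewrite mul0r.
Qed.

(* [majorant S D] says that the Fourier coefficients of [S] are real and
   dominated in absolute value by those of [D]. *)
Definition majorant S D :=
  posdef (fun x => D x + S x) /\ posdef (fun x => D x - S x).

Let half_ge0 : 0 <= (2^-1 : R). Proof. by rewrite invr_ge0. Qed.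
Let half_C : (2^-1)%:C * 2 = 1 :> R[i].
Proof. by rewrite -[2]/(2%:R) -(rmorph_nat (real_complex R)) -rmorphM/= mulVf. Qed.

(** 2 (D D' + S S') = (D + S) (D' + S') + (D - S) (D' - S'), and 2 (D D' - S S') is the sum of the
    two mixed products. *)
Lemma majorantM S D S' D' : majorant S D -> majorant S' D' ->
  majorant (fun x => S x * S' x) (fun x => D x * D' x).
Proof.
move=> [p m] [p' m']; split.
- have := posdefM (posdef_cst half_ge0) (posdefD (posdefM p p') (posdefM m m')).
  apply: eq_posdef => x.
  transitivity ((2^-1)%:C * 2 * (D x * D' x + S x * S' x)); first by ring.
  by rewrite half_C mul1r.
- have := posdefM (posdef_cst half_ge0) (posdefD (posdefM p m') (posdefM m p')).
  apply: eq_posdef => x.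
  transitivity ((2^-1)%:C * 2 * (D x * D' x - S x * S' x)); first by ring.
  by rewrite half_C mul1r.
Qed.

Lemma majorant_dilation (n : nat) S D : majorant S D ->
  majorant (fun x => S (n%:R * x)) (fun x => D (n%:R * x)).
Proof.
move=> [p m].
by split; [exact: (posdef_dilation n p)|exact: (posdef_dilation n m)].
Qed.

Lemma regular_majorant S D : majorant S D -> regular S /\ regular D.
Proof.
move=> [/regular_posdef p /regular_posdef m]; split.
- apply: eq_regular (regularM (regular_cst (2^-1)%:C) (regularD p
    (regularM (regular_cst (-1)) m))) => x.
  transitivity ((2^-1)%:C * 2 * S x); first by ring.
  by rewrite half_C mul1r.
- apply: eq_regular (regularM (regular_cst (2^-1)%:C) (regularD p m)) => x.
  transitivity ((2^-1)%:C * 2 * D x); first by ring.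
  by rewrite half_C mul1r.
Qed.

End complex_functions.

(** * Amplification *)

Section tensor_power.
Context {R : realType}.
Implicit Types (S D f : R -> R[i]) (p q x y : R).

Lemma powR_exprn (r p : R) n : 0 <= r -> (r ^+ n) `^ p = (r `^ p) ^+ n.
Proof.
by move=> r0; rewrite -powR_mulrn// powRAC powR_mulrn// powR_ge0.
Qed.

(* Jensen's inequality, from the tangent line of [t ^ (q / p)] at [t = 1]. *)
Lemma integ_powR_le p q f (A : R) : 0 < q -> q <= p -> regular f -> 0 < A ->
  integ 0 1 (fun x => normc (f x) `^ p) <= A ->
  integ 0 1 (fun x => normc (f x) `^ q) <= A `^ (q / p).
Proof.
move=> q0 qp rf A0 fA; have p0 : 0 < p := lt_le_trans q0 qp.
set k := q / p; have k01 : 0 <= k <= 1.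
  by rewrite /k (divr_ge0 (ltW q0) (ltW p0))/= ler_pdivrMr// mul1r.
have cp := continuous_normc_powR p0 rf.
have Ak : 0 < A `^ k by rewrite powR_gt0.
(* The tangent at [A] of the concave function u^k. Once integrated, it gives A^k (1 - k) + A^k k,
   since [A] bounds the integral. *)
have pw x : normc (f x) `^ q <=
    A `^ k * (1 - k) + (A `^ k * k / A) * normc (f x) `^ p.
  set u := normc (f x) `^ p.
  have u0 : 0 <= u by exact: powR_ge0.
  have := @powR_bernoulli_le R k (u / A) k01 (divr_ge0 u0 (ltW A0)).
  rewrite -(ler_pM2l Ak) -powRM ?(ltW A0) ?divr_ge0 ?(ltW A0)//.
  rewrite mulrC divfK ?gt_eqF//.
  have -> : u `^ k = normc (f x) `^ q by rewrite /u -powRrM mulrC divfK ?gt_eqF.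
  move=> /le_trans; apply; rewrite le_eqVlt; apply/orP; left; apply/eqP.
  by field; rewrite gt_eqF.
apply: (@le_trans _ _ (integ 0 1 (fun x => A `^ k * (1 - k) +
    (A `^ k * k / A) * normc (f x) `^ p))).
  apply: le_integ => //; first exact: continuous_normc_powR.
  by move=> x; apply: cvgD; [exact: continuous_const|exact: (continuousZ_fun _ cp)].
rewrite integD//; last exact: continuousZ_fun.
rewrite integ_cst// subr0 mulr1 integZ//.
apply: (@le_trans _ _ (A `^ k * (1 - k) + A `^ k * k / A * A)).
  apply: lerD => //; apply: ler_wpM2l => //.
  by case/andP: k01 => k0 _; exact: divr_ge0 (mulr_ge0 (ltW Ak) k0) (ltW A0).
by rewrite divfK ?gt_eqF// -mulrDr subrK mulr1.
Qed.

(* For large [N], [x] and [N x] are almost independent, so that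
   [S' x * S (N x)] behaves like a tensor product. *)
Lemma tensor_power p q S D (B alpha beta : R) : 0 < p -> 0 < q ->
  majorant S D -> (forall x, normc (S x) <= B) ->
  integ 0 1 (fun x => normc (D x) `^ p) < alpha ->
  0 < beta -> beta < integ 0 1 (fun x => normc (S x) `^ q) ->
  forall n, exists S' D', [/\ majorant S' D', forall x, normc (S' x) <= B ^+ n,
    integ 0 1 (fun x => normc (D' x) `^ p) <= alpha ^+ n &
    beta ^+ n <= integ 0 1 (fun x => normc (S' x) `^ q)].
Proof.
move=> p0 q0 mSD SB Da b0 bS.
have [rS rD] := regular_majorant mSD.
have [a0 a0E] : {c : R | c = integ 0 1 (fun x => normc (D x) `^ p)} by eexists.
have [b1 b1E] : {c : R | c = integ 0 1 (fun x => normc (S x) `^ q)} by eexists.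
rewrite -a0E in Da; rewrite -b1E in bS.
have a00 : 0 <= a0 by rewrite a0E; apply: integ_ge0 => x; exact: powR_ge0.
have b10 : 0 < b1 := lt_trans b0 bS.
have al0 : 0 < alpha := le_lt_trans a00 Da.
elim=> [|n [S' [D' [mSD' SB' Da' bS']]]].
  exists (fun=> 1), (fun=> 1); split.
  - split; first by apply: eq_posdef (posdef_cst (ler0n R 2)) => x; rewrite rmorph_nat.
    by apply: eq_posdef (posdef_cst (lexx 0)) => x; rewrite subrr.
  - by move=> x; rewrite normc1 expr0.
  - under eq_integ do rewrite normc1 powR1.
    by rewrite integ_cst// expr0 subr0 mulr1.
  - under eq_integ do rewrite normc1 powR1.
    by rewrite integ_cst// expr0 subr0 mulr1.
have [rS' rD'] := regular_majorant mSD'.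
(* The errors are chosen so that (alpha^n + w) a0 <= alpha^(n+1) and (beta^n - v) b1 = beta^(n+1);
   the denominator of [w] is a0 + 1 because a0 may vanish. *)
have [w wE] : {c : R | c = alpha ^+ n * (alpha - a0) / (a0 + 1)} by eexists.
have [v vE] : {c : R | c = beta ^+ n * (b1 - beta) / b1} by eexists.
have w0 : 0 < w.
  by rewrite wE divr_gt0 ?mulr_gt0 ?exprn_gt0 ?subr_gt0// ltr_wpDl.
have v0 : 0 < v by rewrite vE divr_gt0 ?mulr_gt0 ?exprn_gt0 ?subr_gt0.
have fej c (f g : R -> R[i]) e : 0 < c -> regular f -> regular g -> 0 < e ->
   exists N0 : nat, forall N : nat, (N0 <= N)%N -> (0 < N)%N ->
     (integ 0 1 (fun x => normc (f x) `^ c) - e) * integ 0 1 (fun x => normc (g x) `^ c)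
      <= integ 0 1 (fun x => normc (f x * g (N%:R * x)) `^ c)
      <= (integ 0 1 (fun x => normc (f x) `^ c) + e) * integ 0 1 (fun x => normc (g x) `^ c).
  move=> c0 rf rg e0.
  have [N0 HN] := @fejer R _ _ e (continuous_normc_powR c0 rf)
    (continuous_normc_powR c0 rg) (periodic1_normc_powR c rg)
    (fun x => powR_ge0 _ _) e0.
  exists N0 => N NN0 Np.
  have -> : integ 0 1 (fun x => normc (f x * g (N%:R * x)) `^ c) =
     integ 0 1 (fun x => normc (f x) `^ c * normc (g (N%:R * x)) `^ c).
    by apply: eq_integ => x; rewrite normcM powRM// normc_ge0.
  exact: HN.
have [N1 H1] := fej p D' D w p0 rD' rD w0.
have [N2 H2] := fej q S' S v q0 rS' rS v0.
(* One dilation must serve both bounds, since a majorant is preserved only if [S] and [D] are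
   dilated alike. *)
pose N := (maxn N1 N2).+1.
exists (fun x => S' x * S (N%:R * x)), (fun x => D' x * D (N%:R * x)); split.
- by apply: majorantM => //; exact: majorant_dilation.
- move=> x; rewrite normcM exprS mulrC.
  by apply: ler_pM => //; exact: normc_ge0.
- have /andP[_ /le_trans->//] := H1 N (leqW (leq_maxl _ _)) isT.
  rewrite -a0E; apply: (@le_trans _ _ ((alpha ^+ n + w) * a0)).
    by rewrite ler_wpM2r// lerD2r.
  rewrite exprSr mulrDl -lerBrDl -mulrBr wE -mulrA ler_piMr//.
    by rewrite mulr_ge0 ?exprn_ge0 ?subr_ge0 ?(ltW al0) ?(ltW Da).
  by rewrite mulrC ler_pdivrMr ?mul1r ?lerDl// ltr_wpDl.
- have /andP[+ _] := H2 N (leqW (leq_maxr _ _)) isT.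
  apply: le_trans; rewrite -b1E.
  apply: (@le_trans _ _ ((beta ^+ n - v) * b1)); last first.
    by rewrite ler_wpM2r ?(ltW b10)// lerD2r.
  rewrite mulrBl vE divfK ?gt_eqF// exprSr le_eqVlt; apply/orP; left; apply/eqP.
  by ring.
Qed.

End tensor_power.

(** * From a violated majorant inequality to concentration on [E] *)

Section concentration.
Context {R : realType}.
Implicit Types (S D f : R -> R[i]) (p q x y : R).

Lemma exprn_lt_ex (t e : R) : 0 <= t < 1 -> 0 < e -> exists n : nat, t ^+ n < e.
Proof.
move=> /andP[t0 t1] e0.
have /cvgrPdist_lt/(_ _ e0)[n _ nP] : (GRing.exp t : R^nat) @ \oo --> 0.
  by apply: cvg_expr; rewrite ger0_norm.
exists n; have := nP n (leqnn n).
by rewrite /= sub0r normrN ger0_norm// exprn_ge0.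
Qed.

Lemma exprn_gt_ex (t c : R) : 1 < t -> exists n : nat, c < t ^+ n.
Proof.
move=> t1; have t0 : 0 < t by lra.
have c0 : 0 < `|c| + 1 by have := normr_ge0 c; lra.
have [] := @exprn_lt_ex t^-1 (`|c| + 1)^-1.
- by rewrite invr_ge0 (ltW t0) invf_lt1.
- by rewrite invr_gt0.
move=> n; rewrite exprVn ltf_pV2 ?posrE ?exprn_gt0// => h.
by exists n; apply: lt_trans h; have := ler_norm c; lra.
Qed.

Lemma Rintegral_le_integ (A : set R) a b (g h : R -> R) : measurable A ->
  A `<=` `[a, b] -> continuous g -> continuous h -> (forall x, 0 <= h x) ->
  (forall x, A x -> g x <= h x) ->
  Rintegral (@lebesgue_measure R) A g <= integ a b h.
Proof.
move=> mA Aab cg ch h0 gh.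
have iA u : continuous u -> (@lebesgue_measure R).-integrable A (EFin \o u).
  by move=> cu; exact: integrableS (integrable_itv a b cu).
apply: (@le_trans _ _ (Rintegral (@lebesgue_measure R) A h)).
  by apply: le_Rintegral => //; exact: iA.
rewrite /integ /Rintegral fine_le//.
- exact: integrable_fin_num (iA _ ch).
- exact: integrable_fin_num (integrable_itv a b ch).
- apply: ge0_subset_integral => //; last by move=> x _; rewrite lee_fin.
  by have /integrableP[] := integrable_itv a b ch.
Qed.

Lemma ekB_add_ekD k x0 x :
  ek k (x - x0) + ek k (x + x0) = (2 * cos (2 * pi * k%:~R * x0))%:C * ek k x.
Proof.
rewrite /ek (mulrBr _ x x0) (mulrDr _ x x0) cosB cosD sinB sinD.
by apply/eqP; rewrite eq_complex /=; apply/andP; split; apply/eqP; ring.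
Qed.

(** Opposite translates multiply the coefficient of e_k by 2 cos (2 pi k x0), which is real and at
    most 2 in absolute value. The two signs are treated together through [e] with |e| <= 1. *)
Lemma majorant_translates f x0 : posdef f ->
  majorant (fun x => f (x - x0) + f (x + x0)) (fun x => 2 * f x).
Proof.
move=> [s s0 fs].
have sumE x (e : R) : 2 * f x + e%:C * (f (x - x0) + f (x + x0)) =
    \sum_(t <- s) (t.1 * (2 + e * (2 * cos (2 * pi * t.2%:~R * x0))))%:C * ek t.2 x.
  rewrite !fs /tpoly -big_split/= !mulr_sumr -big_split/=; apply: eq_bigr => t _.
  rewrite -mulrDr ekB_add_ekD; set c := 2 * cos _.
  transitivity (t.1%:C * ((2%:R + e%:C * c%:C) * ek t.2 x)); first by ring.
  by rewrite -(rmorph_nat (real_complex R)) -rmorphM -rmorphD mulrA -rmorphM.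
have pos (e : R) : `|e| <= 1 ->
    posdef (fun x => 2 * f x + e%:C * (f (x - x0) + f (x + x0))).
  move=> e1.
  exists [seq (t.1 * (2 + e * (2 * cos (2 * pi * t.2%:~R * x0))), t.2) | t <- s].
    rewrite all_map; apply: sub_all s0 => t /= t0; apply: mulr_ge0 => //.
    have : `|e * cos (2 * pi * t.2%:~R * x0)| <= 1.
      by rewrite normrM mulr_ile1// cos_max.
    by rewrite ler_norml; lra.
  by move=> x; rewrite sumE /tpoly big_map.
split.
- have := pos 1; rewrite normr1 => /(_ (lexx _)).
  by apply: eq_posdef => x; rewrite rmorph1 mul1r.
- have := pos (-1); rewrite normrN1 => /(_ (lexx _)).
  by apply: eq_posdef => x; rewrite rmorphN1 mulN1r.
Qed.

Definition bump x : R := (1 + cos (2 * pi * x)) / 2.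

Lemma bump_ge0 x : 0 <= bump x.
Proof. by rewrite /bump; have := cos_geN1 (2 * pi * x); lra. Qed.

Lemma bump_le1 x : bump x <= 1.
Proof. by rewrite /bump; have := cos_le1 (2 * pi * x); lra. Qed.

Lemma posdef_bump : posdef (fun x => (bump x)%:C).
Proof.
have h4 : 0 <= (4^-1 : R) by rewrite invr_ge0.
have h2 : 0 <= (2^-1 : R) by rewrite invr_ge0.
apply: eq_posdef (posdefD (posdef_cst h2)
  (posdefD (posdef_ek 1 h4) (posdef_ek (-1) h4))) => x.
rewrite /ek /bump; apply/eqP; rewrite eq_complex /=.
rewrite mulr1 mulrN1 mulNr cosN sinN.
by apply/andP; split; apply/eqP; field.
Qed.

(** Reduce [y] to its fractional part z. By evenness the cosine is the same at z and 1 - z; one of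
    them lies in [d, 1/2], where it decreases. *)
Lemma bump_far (d y : R) : 0 < d -> d <= 2^-1 ->
  (forall k : int, d <= `|y - k%:~R|) -> bump y <= bump d.
Proof.
move=> d0 d1 far; rewrite /bump ler_wpM2r ?invr_ge0// lerD2l.
have lecos u v : 0 <= u -> u <= v -> v <= 2^-1 ->
    cos (2 * pi * v) <= cos (2 * pi * u) :> R.
  rewrite le_eqVlt => u0 uv v1; have [->//|] := eqVneq u v => uv'.
  have pi0 := @pi_gt0 R.
  have ltuv : u < v by rewrite lt_neqAle uv' uv.
  have u0' : 0 <= u by rewrite le_eqVlt.
  rewrite ltW// ltr_cos ?in_itv/=.
  - by rewrite ltr_pM2l// mulr_gt0.
  - by apply/andP; split; nra.
  - by apply/andP; split; nra.
have /andP[] := floor_itv y; set n := Num.floor y => ny yn.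
have ec : cos (2 * pi * y) = cos (2 * pi * (y - n%:~R)).
  have := @periodic1_int R _ (@ek R 1) n (y - n%:~R) (@ek_period R 1).
  by rewrite subrK /ek => -[]; rewrite !mulr1.
have ec' : cos (2 * pi * y) = cos (2 * pi * (n%:~R + 1 - y)).
  rewrite ec -[LHS]cosN -mulrN; have := @ek_period R 1 (- (y - n%:~R)).
  by rewrite /ek => -[]; rewrite !mulr1 => <- _; congr cos; ring.
have f1 : d <= y - n%:~R by have := far n; rewrite ger0_norm// subr_ge0.
move: yn; rewrite intrD mulr1z => yn.
have f2 : d <= n%:~R + 1 - y.
  by have := far (n + 1); rewrite intrD mulr1z distrC gtr0_norm// subr_gt0.
have [h|h] := leP (y - n%:~R) 2^-1.
  by rewrite ec lecos// ltW.
by rewrite ec' lecos ?(ltW d0)//; lra.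
Qed.

(** The interval has length 1/L so as to be a cell carrying a full period of a function of L x. *)
Lemma bump_near (t : R) : t < 1 -> exists2 L : nat, (0 < L)%N &
  forall y, 0 <= y <= L%:R^-1 -> t <= bump y.
Proof.
move=> t1.
have cb : continuous bump.
  move=> x; apply: cvgM; last exact: cst_continuous.
  apply: cvgD; first exact: cst_continuous.
  by apply: (@continuous_dilation R _ _ cos); exact: continuous_cos.
have := cb 0; rewrite /continuous_at {2}/bump mulr0 cos0 divff//.
move=> /cvgrPdist_lt/(_ (1 - t)); rewrite subr_gt0 => /(_ t1)[r /= r0 rP].
exists (Num.truncn r^-1).+1 => // y /andP[y0 yL].
have Np : 0 < ((Num.truncn r^-1).+1%:R : R) by rewrite ltr0n.
have yr : y < r.
  apply: le_lt_trans yL _; rewrite invf_plt ?posrE//.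
  exact: truncnS_gt.
have := rP y; rewrite /= sub0r normrN ger0_norm// => /(_ yr).
by rewrite ltr_norml; lra.
Qed.

(* The polynomial is [F x = psi x * S_n (L x) + 2 phi x * D_n (L x)], where
   [phi = bump ^ (K n)] and [psi] is the sum of the translates of [phi] by
   [x0] and [- x0], so that [psi] is exponentially small off [E]. *)
Lemma concentration_of_majorant p q S D (B : R) : 0 < q -> q <= p ->
  majorant S D -> (forall x, normc (S x) <= B) ->
  integ 0 1 (fun x => normc (D x) `^ p) `^ (q / p) <
    integ 0 1 (fun x => normc (S x) `^ q) ->
  concentration p q.
Proof.
move=> q0 qp mSD SB DS E [oE [pE sE]] muE eps eps0.
have p0 : 0 < p := lt_le_trans q0 qp.
have pq0 : 0 < p / q by rewrite divr_gt0.
have [x0 [Ex0 _]] : (E `&` `[0%R, 1%R[) !=set0.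
  apply/set0P/eqP => E0; move: muE.
  by rewrite /torus_measure E0 measure0 ltxx.
have perE : periodic1 E by move=> x; apply/propext; exact: iff_sym (pE x).
have [d [d0 d1 dE]] : exists d : R, [/\ 0 < d, d <= 2^-1 &
    forall y, `|x0 - y| < d -> E y].
  have /nbhs_ballP[r /= r0 rE] : nbhs x0 E by exact: open_nbhs_nbhs.
  exists (Num.min r 2^-1); split; first by rewrite lt_min r0 invr_gt0/=.
  - by rewrite ge_min lexx orbT.
  - by move=> y; rewrite lt_min => /andP[yr _]; exact: rE.
pose theta := bump d.
have th0 : 0 <= theta by exact: bump_ge0.
have th1 : theta < 1.
  have pi0 := @pi_gt0 R.
  have : cos (2 * pi * d) < cos (0 : R).
    by rewrite ltr_cos ?in_itv/=; [nra|apply/andP; split; nra..].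
  by rewrite /theta /bump cos0; lra.
(* By periodicity all of x0 + Z keeps distance at least [d] from the complement of [E], and by
   symmetry so does - x0 + Z. *)
have farE x : ~ E x -> bump (x - x0) <= theta /\ bump (x + x0) <= theta.
  move=> nEx; split; apply: bump_far => // k; rewrite leNgt; apply/negP => hk.
    apply: nEx; rewrite -(@periodic1_int R _ E (- k) x perE) mulrNz.
    by apply: dE; rewrite distrC; congr (`| _ | < d): hk; ring.
  apply: nEx; apply/sE; rewrite -(@periodic1_int R _ E k (- x) perE).
  by apply: dE; congr (`| _ | < d): hk; ring.
move: DS; set a0 := integ _ _ _; set b0 := integ _ _ _ => ab.
have a00 : 0 <= a0 by apply: integ_ge0 => x; exact: powR_ge0.
have ap0 : 0 <= a0 `^ (q / p) by exact: powR_ge0.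
(* The gap is cut in three: b1 is the rate of growth allowed to [D], b2 the one guaranteed for [S],
   and the ratio b2 / b1 pays for the damping near x0. *)
have [b1 [b2 [b1a b12 b2b]]] :
    exists b1 b2 : R, [/\ a0 `^ (q / p) < b1, b1 < b2 & b2 < b0].
  by exists ((2 * a0 `^ (q / p) + b0) / 3), ((a0 `^ (q / p) + 2 * b0) / 3);
    split; lra.
have b10 : 0 < b1 by lra.
have b20 : 0 < b2 by lra.
pose r := b1 `^ q^-1; have r0 : 0 < r by rewrite powR_gt0.
have rq : r `^ q = b1 by rewrite /r -powRrM mulVf ?gt_eqF// powRr1// ltW.
have rpE : r `^ p = b1 `^ (p / q) by rewrite /r -powRrM mulrC.
have Dr : a0 < r `^ p.
  have -> : a0 = (a0 `^ (q / p)) `^ (p / q).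
    rewrite -powRrM (_ : _ * _ = 1) ?powRr1//.
    by field; rewrite !gt_eqF.
  by rewrite rpE gt0_ltr_powR ?nnegrE// ltW.
have B0 : 0 <= B by apply: le_trans (SB 0); exact: normc_ge0.
(* [K] makes theta^K B <= r, so that the [n]-th powers are comparable off [E]. [B] may be 0, whence
   B + 1; the successor makes [K] positive, as the choice of [tau] requires. *)
have [K0 HK0] : exists K : nat, theta ^+ K < r / (B + 1).
  by apply: exprn_lt_ex; [rewrite th0|rewrite divr_gt0//; lra].
pose K := K0.+1.
have HK : theta ^+ K * B <= r.
  apply: (@le_trans _ _ (theta ^+ K0 * (B + 1))).
    apply: ler_pM; rewrite ?exprn_ge0//; last by lra.
    by rewrite exprSr ler_piMr ?exprn_ge0// ltW.
  by rewrite -ler_pdivlMr ?ltW//; lra.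
(* [tau] solves tau^(K q) = v, where [v] is the midpoint of b1 / b2 and 1. *)
have [tau [t0 t1 b12t]] : exists tau : R,
    [/\ 0 < tau, tau < 1 & b1 < b2 * (tau ^+ K) `^ q].
  pose v := (1 + b1 / b2) / 2.
  have u1 : b1 / b2 < 1 by rewrite ltr_pdivrMr// mul1r.
  have u0 : 0 < b1 / b2 by rewrite divr_gt0.
  have v0 : 0 < v by rewrite /v; lra.
  have Kq : 0 < K%:R * q by rewrite mulr_gt0// ltr0n.
  exists (v `^ (K%:R * q)^-1); split.
  - by rewrite powR_gt0.
  - have Kq' : 0 < (K%:R * q)^-1 by rewrite invr_gt0.
    have := @gt0_ltr_powR R _ Kq' v 1; rewrite powR1; apply.
    + by rewrite nnegrE ltW.
    + by rewrite nnegrE.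
    + by rewrite /v; lra.
  - rewrite -powR_mulrn ?powR_ge0// -!powRrM mulVf ?gt_eqF//.
    rewrite powRr1 ?(ltW v0)// (mulrC b2) -ltr_pdivrMr//.
    by rewrite /v; lra.
have [L L0 HL] := bump_near t1.
have Lp : 0 < (L%:R : R) by rewrite ltr0n.
have Lp1 : (L%:R^-1 : R) <= 1 by rewrite invf_le1// ler1n.
have [b3 b3E] : {c : R | c = b2 * (tau ^+ K) `^ q}.
  by exists (b2 * (tau ^+ K) `^ q).
rewrite -b3E in b12t.
(* One factor 2^p comes from [powRD_le], the other from the coefficient 2 in front of both terms. *)
have [cp cpE] : {c : R | c = 2 `^ p * 2 `^ p} by exists (2 `^ p * 2 `^ p).
have [cq cqE] : {c : R | c = 2 `^ q} by exists (2 `^ q).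
have cp0 : 0 < cp by rewrite cpE mulr_gt0 ?powR_gt0.
have cq0 : 0 < cq by rewrite cqE powR_gt0.
(* Chosen so that eps * kap^(p/q) = 2 cp: it then suffices that the integral of |F|^q is at least
   kap * b1^n. *)
have [kap kapE] : {c : R | c = (2 * cp / eps) `^ (q / p)}.
  by exists ((2 * cp / eps) `^ (q / p)).
have kap0 : 0 < kap by rewrite kapE powR_gt0// divr_gt0// mulr_gt0.
have [n Hn] : exists n : nat, L%:R * cq * (kap + cq) < (b3 / b1) ^+ n.
  by apply: exprn_gt_ex; rewrite ltr_pdivlMr// mul1r.
have [Sn [Dn [mn SBn Dan bSn]]] := tensor_power p0 q0 mSD SB Dr b20 b2b n.
have [rSn rDn] := regular_majorant mn.
pose m := (K * n)%N.
pose phi x : R[i] := ((bump x)%:C) ^+ m.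
have phiE x : phi x = (bump x ^+ m)%:C by rewrite /phi rmorphXn.
have pphi : posdef phi by exact: (posdefX m posdef_bump).
pose psi x := phi (x - x0) + phi (x + x0).
pose F x := (2 * phi x) * Dn (L%:R * x) + psi x * Sn (L%:R * x).
have mphi := majorant_translates x0 pphi.
have pF : posdef F.
  by have [] := majorantM mphi (majorant_dilation L mn).
have rF := regular_posdef pF.
have npsi x : normc (psi x) = bump (x - x0) ^+ m + bump (x + x0) ^+ m.
  rewrite /psi !phiE -rmorphD normc_real ger0_norm//.
  by rewrite addr_ge0// exprn_ge0// bump_ge0.
have nphi x : normc (2 * phi x) <= 2.
  rewrite phiE -(rmorph_nat (real_complex R)) -rmorphM normc_real.
  rewrite ger0_norm ?mulr_ge0 ?exprn_ge0 ?bump_ge0//.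
  by rewrite ler_piMr// exprn_ile1 ?bump_ge0 ?bump_le1.
have nD x : normc ((2 * phi x) * Dn (L%:R * x)) <= 2 * normc (Dn (L%:R * x)).
  by rewrite normcM ler_wpM2r// normc_ge0.
have rDL := regular_dilation L rDn.
have rSL := regular_dilation L rSn.
have [I IE] : {c : R | c = integ 0 1 (fun x => normc (F x) `^ q)}.
  by exists (integ 0 1 (fun x => normc (F x) `^ q)).
have Dqn : integ 0 1 (fun x => normc (Dn x) `^ q) <= b1 ^+ n.
  have h : 0 < (r `^ p) ^+ n by rewrite exprn_gt0// powR_gt0.
  apply: le_trans (integ_powR_le q0 qp rDn h Dan) _.
  rewrite -powR_exprn ?(ltW r0)// -powRrM mulrC divfK ?gt_eqF//.
  by rewrite powR_exprn ?(ltW r0)// rq.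
(* On the cell starting at x0, |psi| >= tau^m, hence tau^m |S_n (L x)| <= |F x| + 2 |D_n (L x)|. The
   cell sees a full period of S_n (L x), and Jensen's inequality bounds the contribution of D_n by
   b1^n. *)
have lower : b3 ^+ n / L%:R <= cq * (I + cq * b1 ^+ n).
  have cS : continuous (fun x => normc (Sn (L%:R * x)) `^ q).
    exact: continuous_normc_powR.
  have cF := continuous_normc_powR q0 rF.
  have cDL := continuous_normc_powR q0 rDL.
  have ccDL := continuousZ_fun cq cDL.
  have cG : continuous (fun x =>
      cq * (normc (F x) `^ q + cq * normc (Dn (L%:R * x)) `^ q)).
    apply: continuousM_fun => //.
    by move=> x; apply: cvgD; [exact: cF|exact: ccDL].
  have G0 x : 0 <= cq * (normc (F x) `^ q + cq * normc (Dn (L%:R * x)) `^ q).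
    by rewrite mulr_ge0 ?addr_ge0 ?mulr_ge0 ?powR_ge0 ?(ltW cq0).
  apply: (@le_trans _ _ (integ x0 (x0 + L%:R^-1)
    (fun x => (tau ^+ m) `^ q * normc (Sn (L%:R * x)) `^ q))).
    rewrite integZ// (@integ_dilation_cell _ _ _ (fun x => normc (Sn x) `^ q))//.
    - rewrite [X in _ <= X]mulrCA [X in X <= _]mulrC.
      apply: ler_wpM2l; first by rewrite invr_ge0 (ltW Lp).
      rewrite b3E exprMn [X in X <= _]mulrC /m exprM.
      rewrite (@powR_exprn _ (tau ^+ K)) ?exprn_ge0 ?(ltW t0)//.
      by apply: ler_wpM2l => //; rewrite exprn_ge0// powR_ge0.
    - exact: continuous_normc_powR.
    - exact: periodic1_normc_powR.
  apply: (@le_trans _ _ (integ x0 (x0 + L%:R^-1)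
     (fun x => cq * (normc (F x) `^ q + cq * normc (Dn (L%:R * x)) `^ q)))).
    apply: le_integ => //; first exact: continuousM_fun.
    move=> x /andP[xl xr].
    have taupsi : tau ^+ m <= normc (psi x).
      rewrite npsi; apply: (@le_trans _ _ (bump (x - x0) ^+ m)); last first.
        by rewrite lerDl exprn_ge0// bump_ge0.
      rewrite lerXn2r ?nnegrE ?bump_ge0 ?(ltW t0)//.
      by apply: HL; rewrite subr_ge0 xl lerBlDl.
    rewrite -powRM ?exprn_ge0 ?normc_ge0 ?(ltW t0)//.
    apply: (@le_trans _ _ ((normc (F x) + 2 * normc (Dn (L%:R * x))) `^ q)).
      rewrite ge0_ler_powR ?nnegrE ?(ltW q0) ?mulr_ge0 ?addr_ge0 ?mulr_ge0
        ?exprn_ge0 ?normc_ge0 ?(ltW t0)//.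
      apply: (@le_trans _ _ (normc (psi x * Sn (L%:R * x)))).
        by rewrite normcM ler_wpM2r// normc_ge0.
      have -> : psi x * Sn (L%:R * x) = F x + - ((2 * phi x) * Dn (L%:R * x)).
        by rewrite /F; ring.
      apply: le_trans (normc_leD _ _) _; rewrite lerD2l.
      by rewrite -mulN1r normcM normcN normc1 mul1r.
    apply: le_trans (powRD_le q0 (normc_ge0 _) _) _.
      by rewrite mulr_ge0// normc_ge0.
    by rewrite (@powRM _ 2) ?normc_ge0// -cqE.
  apply: (@le_trans _ _ (integ x0 (x0 + 1)
     (fun x => cq * (normc (F x) `^ q + cq * normc (Dn (L%:R * x)) `^ q)))).
    by apply: integ_le_sub => //; [rewrite lerDl invr_ge0 ltW|rewrite lerD2l].
  rewrite integ_period//; last first.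
    by move=> x; rewrite (periodic1_normc_powR q rF) (periodic1_normc_powR q rDL).
  rewrite integZ; last first.
    by move=> x; apply: cvgD; [exact: cF|exact: ccDL].
  apply: ler_wpM2l; first exact: ltW.
  rewrite integD// -IE lerD2l integZ//.
  apply: ler_wpM2l; first exact: ltW.
  rewrite (@integ_dilation _ _ (fun x => normc (Dn x) `^ q))//.
  - exact: continuous_normc_powR.
  - exact: periodic1_normc_powR.
have Ilow : kap * b1 ^+ n <= I.
  have bn0 : 0 < b1 ^+ n by rewrite exprn_gt0.
  have : L%:R * cq * (kap + cq) * b1 ^+ n < b3 ^+ n.
    by rewrite -ltr_pdivlMr// -expr_div_n.
  have := lower; rewrite ler_pdivrMr// => h1 h2.
  have : L%:R * cq * ((kap + cq) * b1 ^+ n) <= L%:R * cq * (I + cq * b1 ^+ n).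
    by rewrite mulrA (le_trans (ltW h2))// (le_trans h1)// mulrC mulrA.
  by rewrite ler_pM2l ?mulr_gt0// mulrDl lerD2r.
have I0 : 0 < I by apply: lt_le_trans Ilow; rewrite mulr_gt0// exprn_gt0.
have [x1 Fx1] : exists x1, F x1 != 0.
  apply: contrapT => nF; move: I0.
  have -> : I = integ 0 1 (fun=> 0).
    rewrite IE.
    apply: eq_integ => x; have [->|Fx] := eqVneq (F x) 0.
      by rewrite normc0 powR0// gt_eqF.
    by exfalso; apply: nF; exists x.
  by rewrite integ_cst// mul0r ltxx.
have [H [a [Ha absE]]] := pos_def_tp_of_posdef pF Fx1.
exists H, a; split => //.
have -> : (fun x => tp_abs H a x `^ p) = (fun x => normc (F x) `^ p).
  by apply/funext => x; rewrite absE.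
have -> : (fun x => tp_abs H a x `^ q) = (fun x => normc (F x) `^ q).
  by apply/funext => x; rewrite absE.
rewrite integ_bndo -?IE; last exact: continuous_normc_powR.
pose G x := cp * ((r `^ p) ^+ n + normc (Dn (L%:R * x)) `^ p).
have cDp := continuous_normc_powR p0 rDL.
have cG : continuous G.
  apply: continuousM_fun => // x.
  by apply: cvgD; [exact: continuous_const|exact: cDp].
apply: (@le_trans _ _ (integ 0 1 G)).
  apply: Rintegral_le_integ => //.
  - by apply: measurableD => //; exact: open_measurable.
  - by move=> x [/= + _]; rewrite !in_itv/= => /andP[-> /ltW ->].
  - exact: continuous_normc_powR.
  - by move=> x; rewrite /G mulr_ge0 ?addr_ge0 ?exprn_ge0 ?powR_ge0// ltW.
  move=> x [_ /farE[f1 f2]].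
  (* As m = K n, the bound 2 theta^m B^n is 2 (theta^K B)^n. *)
  have Sx : normc (psi x * Sn (L%:R * x)) <= 2 * r ^+ n.
    rewrite normcM npsi.
    apply: (@le_trans _ _ ((2 * theta ^+ m) * B ^+ n)).
      apply: ler_pM; rewrite ?normc_ge0 ?addr_ge0 ?exprn_ge0 ?bump_ge0//.
      have lx t : bump t <= theta -> bump t ^+ m <= theta ^+ m.
        by move=> h; rewrite lerXn2r ?nnegrE ?bump_ge0.
      by rewrite mulr_natl mulr2n lerD ?lx.
    rewrite -mulrA ler_wpM2l// /m exprM -exprMn lerXn2r ?nnegrE ?(ltW r0)//.
    by rewrite mulr_ge0 ?exprn_ge0.
  apply: (@le_trans _ _ ((2 * r ^+ n + 2 * normc (Dn (L%:R * x))) `^ p)).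
    rewrite ge0_ler_powR ?nnegrE ?(ltW p0) ?normc_ge0//.
      by rewrite addr_ge0 ?mulr_ge0 ?exprn_ge0 ?normc_ge0 ?(ltW r0).
    by apply: le_trans (normc_leD _ _) _; rewrite addrC lerD.
  apply: le_trans (powRD_le p0 _ _) _.
  - by rewrite mulr_ge0 ?exprn_ge0 ?(ltW r0).
  - by rewrite mulr_ge0 ?normc_ge0.
  rewrite !powRM ?exprn_ge0 ?normc_ge0 ?(ltW r0)// -mulrDr mulrA -cpE.
  by rewrite powR_exprn ?(ltW r0).
rewrite /G integZ; last by move=> x; apply: cvgD; [exact: continuous_const|exact: cDp].
rewrite integD// integ_cst// subr0 mulr1.
rewrite (@integ_dilation _ _ (fun x => normc (Dn x) `^ p))//; last 2 first.
- exact: continuous_normc_powR.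
- exact: periodic1_normc_powR.
apply: (@le_trans _ _ (2 * cp * (r `^ p) ^+ n)).
  have -> : 2 * cp * (r `^ p) ^+ n = cp * ((r `^ p) ^+ n + (r `^ p) ^+ n) by ring.
  by apply: ler_wpM2l; [exact: ltW|rewrite lerD2l].
apply: (@le_trans _ _ (eps * (kap * b1 ^+ n) `^ (p / q))).
  rewrite powRM ?(ltW kap0) ?exprn_ge0 ?(ltW b10)// powR_exprn ?(ltW b10)// -rpE.
  rewrite kapE -powRrM (_ : q / p * (p / q) = 1); last by field; rewrite !gt_eqF.
  rewrite powRr1; last by rewrite divr_ge0 ?mulr_ge0 ?(ltW cp0) ?(ltW eps0).
  rewrite le_eqVlt; apply/orP; left; apply/eqP.
  by field; rewrite gt_eqF.
rewrite ler_wpM2l ?(ltW eps0)// ge0_ler_powR ?nnegrE ?(ltW pq0) ?(ltW I0)//.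
by rewrite mulr_ge0 ?exprn_ge0 ?(ltW kap0) ?(ltW b10).
Qed.

End concentration.

(** * Failure of the majorant property below 2 *)

Section below_two.
Context {R : realType}.
Implicit Types (p q x y : R).

Lemma continuous_cos2pi : continuous (fun x : R => cos (2 * pi * x)).
Proof. by apply: (@continuous_dilation R _ _ cos); exact: continuous_cos. Qed.

Lemma continuous_sin2pi : continuous (fun x : R => sin (2 * pi * x)).
Proof. by apply: (@continuous_dilation R _ _ sin); exact: continuous_sin. Qed.

Lemma periodic1_cos2pi : periodic1 (fun x : R => cos (2 * pi * x)).
Proof.
move=> x; have := @ek_period R 1 x; rewrite /ek => -[].
by rewrite !mulr1.
Qed.

Lemma integ_translate (h : R -> R) (c : R) : continuous h -> periodic1 h ->
  integ 0 1 (fun x => h (x + c)) = integ 0 1 h.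
Proof.
by move=> ch ph; rewrite -integ_shift// add0r addrC integ_period.
Qed.

(* Translating by half a period changes the sign of the cosine. *)
Lemma integ_cos2pi : integ 0 1 (fun x : R => cos (2 * pi * x)) = 0.
Proof.
have := integ_translate 2^-1 continuous_cos2pi periodic1_cos2pi.
have -> : integ 0 1 (fun x : R => cos (2 * pi * (x + 2^-1))) =
    - integ 0 1 (fun x : R => cos (2 * pi * x)).
  rewrite -mulN1r -integZ; last exact: continuous_cos2pi.
  apply: eq_integ => x; rewrite mulN1r -cosDpi; congr cos.
  by field.
by lra.
Qed.

(* Translating by a quarter of a period exchanges the two squares. *)
Lemma integ_cos2pi_sqr : integ 0 1 (fun x : R => cos (2 * pi * x) ^+ 2) = 2^-1.
Proof.
have c2 : continuous (fun x : R => cos (2 * pi * x) ^+ 2).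
  by apply: (@continuousM_fun R _ _ continuous_cos2pi continuous_cos2pi).
have s2 : continuous (fun x : R => sin (2 * pi * x) ^+ 2).
  by apply: (@continuousM_fun R _ _ continuous_sin2pi continuous_sin2pi).
have p2 : periodic1 (fun x : R => cos (2 * pi * x) ^+ 2).
  by move=> x; rewrite periodic1_cos2pi.
have := integ_translate 4^-1 c2 p2.
have -> : integ 0 1 (fun x : R => cos (2 * pi * (x + 4^-1)) ^+ 2) =
    integ 0 1 (fun x : R => sin (2 * pi * x) ^+ 2).
  apply: eq_integ => x.
  have -> : 2 * pi * (x + 4^-1) = 2 * pi * x + pi / 2 :> R by field.
  by rewrite cosDpihalf sqrrN.
have : integ 0 1 (fun x : R => cos (2 * pi * x) ^+ 2 + sin (2 * pi * x) ^+ 2) = 1.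
  under eq_integ do rewrite cos2Dsin2.
  by rewrite integ_cst// subr0 mulr1.
rewrite integD//; lra.
Qed.

Lemma integ_sin2pi_sqr : integ 0 1 (fun x : R => sin (2 * pi * x) ^+ 2) = 2^-1.
Proof.
have -> : integ 0 1 (fun x : R => sin (2 * pi * x) ^+ 2) =
    integ 0 1 (fun x : R => 1 - cos (2 * pi * x) ^+ 2).
  by apply: eq_integ => x; rewrite sin2cos2.
rewrite integB//; last first.
  exact: (@continuousM_fun R _ _ continuous_cos2pi continuous_cos2pi).
by rewrite integ_cst// integ_cos2pi_sqr; lra.
Qed.

(* With [D = 1 + 2 a cos t] and [S = 1 + 2 i a sin t], where [t = 2 pi x],
   the integral of [D ^ p] is at most [1 + 2 (p - 1) a^2], whereas that of
   [|S| ^ q] is at least [1 + q a^2] up to higher order terms in [a]. *)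
Lemma concentration_lt2 p q : 0 < q -> q <= p -> p < 2 -> concentration p q.
Proof.
move=> q0 qp p2; have p0 : 0 < p := lt_le_trans q0 qp.
(* With a < 1/4 the polynomial [D] is positive, so it equals its modulus. For p > 1 the inequality
   to reach at the end is 2 (p - 1) (1 + 4 a^2) < p, that is (p - 1) (2 - p)^2 / 8 < 2 - p. The
   exponent q cancels, so [a] depends on [p] only. *)
pose a : R := (2 - p) / 8.
have a0 : 0 < a by rewrite /a; lra.
have a1 : a < 4^-1 by rewrite /a; lra.
pose D x : R[i] := 1 + (a%:C * ek 1 x + a%:C * ek (-1) x).
pose S x : R[i] := 1 + (a%:C * ek 1 x - a%:C * ek (-1) x).
have mSD : majorant S D.
  have ha : 0 <= 2 * a by lra.
  split.
  - apply: eq_posdef (posdefD (posdef_cst (ler0n R 2)) (posdef_ek 1 ha)) => x.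
    by rewrite /S /D rmorphM !rmorph_nat; ring.
  - apply: eq_posdef (posdef_ek (-1) ha) => x.
    by rewrite /S /D rmorphM !rmorph_nat; ring.
pose d x : R := 1 + (2 * a) * cos (2 * pi * x).
have ca (x : R) : -1 <= cos (2 * pi * x) <= 1 by rewrite cos_geN1 cos_le1.
have d0 x : 0 <= d x by rewrite /d; have := ca x; nra.
have nD x : normc (D x) = d x.
  rewrite -[RHS]ger0_norm// -normc_real; congr normc.
  rewrite /D /d /ek; apply/eqP; rewrite eq_complex /=.
  rewrite mulr1 mulrN1 mulNr cosN sinN.
  by apply/andP; split; apply/eqP; ring.
have nS x : normc (S x) = Num.sqrt (1 + 4 * a ^+ 2 * sin (2 * pi * x) ^+ 2).
  rewrite normcE_ReIm; congr Num.sqrt; rewrite /S /ek /=.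
  by rewrite mulr1 mulrN1 mulNr cosN sinN; ring.
have s1 (x : R) : 0 <= sin (2 * pi * x) ^+ 2 <= 1.
  by rewrite sqr_ge0/= sin2cos2; have := sqr_ge0 (cos (2 * pi * x)); lra.
have SB x : normc (S x) <= 2.
  rewrite nS -[leRHS]ger0_norm// -sqrtr_sqr ler_sqrt//.
  by have := s1 x; nra.
have cd : continuous d.
  move=> x; apply: cvgD; first exact: continuous_const.
  exact: (continuousZ_fun (2 * a) continuous_cos2pi).
have id1 : integ 0 1 d = 1.
  rewrite /d integD//; last exact: (continuousZ_fun (2 * a) continuous_cos2pi).
  rewrite integ_cst// integZ; last exact: continuous_cos2pi.
  by rewrite integ_cos2pi; lra.
have cc2 : continuous (fun x : R => cos (2 * pi * x) ^+ 2).
  by apply: (@continuousM_fun R _ _ continuous_cos2pi continuous_cos2pi).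
have id2 : integ 0 1 (fun x => d x * (d x - 1)) = 2 * a ^+ 2.
  have -> : integ 0 1 (fun x => d x * (d x - 1)) =
     integ 0 1 (fun x => (2 * a) * cos (2 * pi * x) + (4 * a ^+ 2) * cos (2 * pi * x) ^+ 2).
    by apply: eq_integ => x; rewrite /d; ring.
  rewrite integD; last 2 first.
  - exact: (continuousZ_fun (2 * a) continuous_cos2pi).
  - exact: (continuousZ_fun (4 * a ^+ 2) cc2).
  rewrite !integZ//; last exact: continuous_cos2pi.
  by rewrite integ_cos2pi integ_cos2pi_sqr; field.
have cdp : continuous (fun x => d x `^ p) by exact: continuous_powR_comp.
(* For p <= 1 the tangent at 1 suffices, since [d] has mean 1. For p > 1 write d^p = d * d^(p-1) and
   use the tangent of the concave second factor. *)
have Dp : integ 0 1 (fun x => d x `^ p) <= 1 + Num.max 0 (p - 1) * (2 * a ^+ 2).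
  have [p1|p1] := leP (p - 1) 0.
    rewrite mul0r addr0.
    apply: (@le_trans _ _ (integ 0 1 (fun x => 1 + (p * d x - p)))).
      apply: le_integ => //.
        move=> x; apply: cvgD; first exact: continuous_const.
        by apply: cvgB; [exact: (continuousZ_fun p cd)|exact: continuous_const].
      move=> x _; apply: le_trans (powR_bernoulli_le _ (d0 x)) _; first by lra.
      by lra.
    rewrite integD// ?integB// ?integ_cst// ?integZ// ?id1; last 2 first.
    + exact: (continuousZ_fun p cd).
    + by move=> x; apply: cvgB; [exact: (continuousZ_fun p cd)|exact: continuous_const].
    by lra.
  apply: (@le_trans _ _ (integ 0 1 (fun x => d x + (p - 1) * (d x * (d x - 1))))).
    have cdd : continuous (fun x => d x * (d x - 1)).
      apply: continuousM_fun => //; move=> x.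
      by apply: cvgB; [exact: cd|exact: continuous_const].
    apply: le_integ => //.
      by move=> x; apply: cvgD; [exact: cd|exact: (continuousZ_fun (p - 1) cdd)].
    move=> x _; rewrite -mulr_powRB1//.
    have -> : d x + (p - 1) * (d x * (d x - 1)) = d x * (1 + (p - 1) * (d x - 1)) by ring.
    rewrite ler_wpM2l//; apply: powR_bernoulli_le => //; lra.
  have cdd : continuous (fun x => d x * (d x - 1)).
    apply: continuousM_fun => //; move=> x.
    by apply: cvgB; [exact: cd|exact: continuous_const].
  rewrite integD//; last exact: (continuousZ_fun (p - 1) cdd).
  by rewrite integZ// id1 id2.
have cs2 : continuous (fun x : R => sin (2 * pi * x) ^+ 2).
  by apply: (@continuousM_fun R _ _ continuous_sin2pi continuous_sin2pi).
have [rS rD] := regular_majorant mSD.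
(* Apply [powR_ge1B] with exponent q / 2 to 1 + u, where |S|^2 = 1 + u, then bound the denominator 1
   + u by 1 + 4 a^2. *)
have Sq : 1 + q * a ^+ 2 / (1 + 4 * a ^+ 2) <= integ 0 1 (fun x => normc (S x) `^ q).
  pose k := q / 2 * (4 * a ^+ 2) / (1 + 4 * a ^+ 2).
  have a2 : 0 < 1 + 4 * a ^+ 2 by have := sqr_ge0 a; lra.
  apply: (@le_trans _ _ (integ 0 1 (fun x => 1 + k * sin (2 * pi * x) ^+ 2))).
    rewrite integD//; last exact: (continuousZ_fun k cs2).
    rewrite integ_cst// integZ// integ_sin2pi_sqr /k.
    rewrite le_eqVlt; apply/orP; left; apply/eqP.
    by field; rewrite gt_eqF.
  apply: le_integ => //.
  - by move=> x; apply: cvgD; [exact: continuous_const|exact: (continuousZ_fun k cs2)].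
  - exact: continuous_normc_powR.
  move=> x _; rewrite nS -powR12_sqrt; last first.
    by have := s1 x; have := sqr_ge0 a; nra.
  rewrite -powRrM; set u := 4 * a ^+ 2 * sin _ ^+ 2.
  have u0 : 0 <= u by rewrite /u; have := s1 x; have := sqr_ge0 a; nra.
  have u1 : u <= 4 * a ^+ 2 by rewrite /u; have := s1 x; have := sqr_ge0 a; nra.
  have h2q : 0 <= 2^-1 * q by lra.
  apply: le_trans (@powR_ge1B R (2^-1 * q) (1 + u) h2q _); last by lra.
  have -> : 1 - (1 + u)^-1 = u / (1 + u) by field; rewrite gt_eqF//; lra.
  have -> : k * sin (2 * pi * x) ^+ 2 = 2^-1 * q * (u / (1 + 4 * a ^+ 2)).
    by rewrite /k /u; field; rewrite gt_eqF.
  rewrite lerD2l ler_wpM2l// ler_wpM2l// lef_pV2 ?posrE//; lra.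
apply: (@concentration_of_majorant R p q S D 2) => //.
apply: lt_le_trans Sq.
under eq_integ do rewrite nD.
set A := integ _ _ _ in Dp *.
have A0 : 0 <= A by apply: integ_ge0 => x; exact: powR_ge0.
have qp01 : 0 <= q / p <= 1.
  by rewrite (divr_ge0 (ltW q0) (ltW p0))/= ler_pdivrMr// mul1r.
apply: le_lt_trans (powR_bernoulli_le qp01 A0) _; rewrite ltrD2l.
apply: (@le_lt_trans _ _ (q / p * (Num.max 0 (p - 1) * (2 * a ^+ 2)))).
  by apply: ler_wpM2l; [case/andP: qp01|lra].
have a2 : 0 < 1 + 4 * a ^+ 2 by have := sqr_ge0 a; lra.
have aa : 0 < a ^+ 2 by rewrite exprn_gt0.
rewrite ltr_pdivlMr//.
have -> : q / p * (Num.max 0 (p - 1) * (2 * a ^+ 2)) * (1 + 4 * a ^+ 2) =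
   (q * a ^+ 2) * ((2 * Num.max 0 (p - 1) * (1 + 4 * a ^+ 2)) / p).
  by field; rewrite gt_eqF.
have qa : 0 < q * a ^+ 2 by exact: mulr_gt0.
rewrite -[ltRHS]mulr1 (ltr_pM2l qa) ltr_pdivrMr// mul1r.
have [p1|p1] := leP (p - 1) 0; first by rewrite mulr0 mul0r.
rewrite /a; have : (2 - p) * (2 - p) < 2 - p by nra.
nra.
Qed.

End below_two.

(** * Failure of the majorant property above 2 *)

Section above_two.
Context {R : realType}.
Implicit Types (p q c s x y : R) (j : nat).

Definition cosn j x : R := cos (2 * pi * j%:R * x).

(* The squared modulus of [1 + e_1]. *)
Definition vnorm x : R := 2 + 2 * cos (2 * pi * x).

Lemma vnorm_ge0 x : 0 <= vnorm x.
Proof. by rewrite /vnorm; have := cos_geN1 (2 * pi * x); lra. Qed.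

Lemma continuous_vnorm : continuous vnorm.
Proof.
move=> x; apply: cvgD; first exact: continuous_const.
exact: (continuousZ_fun 2 continuous_cos2pi).
Qed.

Lemma continuous_cosn j : continuous (cosn j).
Proof. by apply: (@continuous_dilation R _ _ cos); exact: continuous_cos. Qed.

Lemma periodic1_cosn j : periodic1 (cosn j).
Proof.
move=> x; have := @ek_period R j%:Z x; rewrite /ek => -[].
by rewrite -pmulrn.
Qed.

(* Up to a positive factor, the derivative at [s = 0] of the integral of
   [`|1 + e_1 + s e_(j+1)|^(2 c)]. *)
Definition moment c j : R :=
  integ 0 1 (fun x => vnorm x `^ (c - 1) * (cosn j.+1 x + cosn j x)).

Lemma is_derive_dilation (f : R -> R) (k x df : R) :
  is_derive (k * x) 1 f df -> is_derive x 1 (fun y => f (k * y)) (k * df).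
Proof.
move=> fx.
have dk : is_derive x 1 (fun y : R => k * y) k.
  have -> : (fun y : R => k * y) = k \*: (@id R) by [].
  by apply: is_derive_eq; rewrite /GRing.scale/= mulr1.
by have := @is_derive1_comp R f (fun y => k * y) x df k fx dk; rewrite mulrC.
Qed.

Lemma is_derive_vnorm_powR_sin c j x : 0 < vnorm x ->
  is_derive x 1 (fun y => vnorm y `^ c * sin (2 * pi * j%:R * y))
    (2 * pi * (vnorm x `^ c * (j%:R * cosn j x) -
       2 * c * vnorm x `^ (c - 1) * (sin (2 * pi * x) * sin (2 * pi * j%:R * x)))).
Proof.
move=> v0.
have dv : is_derive x 1 vnorm (- (2 * (2 * pi * sin (2 * pi * x)))).
  have dc := @is_derive_dilation cos (2 * pi) x _ (is_derive_cos _).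
  have -> : vnorm = cst 2 + (2 \*: (fun y : R => cos (2 * pi * y))) by [].
  by apply: is_derive_eq; rewrite add0r /GRing.scale/=; ring.
have dp := @is_derive1_comp R (fun t => t `^ c) vnorm x _ _ (is_derive1_powR c v0) dv.
have ds := @is_derive_dilation sin (2 * pi * j%:R) x _ (is_derive_sin _).
have := @is_deriveM _ _ _ _ _ _ _ _ dp ds.
have -> : ((fun t => t `^ c) \o vnorm) * (fun y => sin (2 * pi * j%:R * y)) =
  (fun y => vnorm y `^ c * sin (2 * pi * j%:R * y)) by [].
move=> h; apply: is_derive_eq.
by rewrite /GRing.scale /cosn /=; ring.
Qed.

(* Integrate the derivative of [vnorm ^ c * sin ((j + 1) t)] over the period
   [[-1/2, 1/2]], at whose end points [vnorm] vanishes. *)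
Lemma moment_rec c j : 1 < c ->
  (c + j.+1%:R) * moment c j.+1 = (c - j.+1%:R) * moment c j.
Proof.
move=> c1.
have cw : continuous (fun x => vnorm x `^ (c - 1)).
  by apply: continuous_powR_comp; [lra|exact: continuous_vnorm|exact: vnorm_ge0].
have cv : continuous (fun x => vnorm x `^ c).
  by apply: continuous_powR_comp; [lra|exact: continuous_vnorm|exact: vnorm_ge0].
have csum i : continuous (fun x => cosn i.+1 x + cosn i x).
  by move=> x; apply: cvgD; exact: continuous_cosn.
have cint i : continuous (fun x => vnorm x `^ (c - 1) * (cosn i.+1 x + cosn i x)).
  exact: continuousM_fun.
pose g x := 2 * pi * ((c + j.+1%:R) * (vnorm x `^ (c - 1) * (cosn j.+2 x + cosn j.+1 x))
   - (c - j.+1%:R) * (vnorm x `^ (c - 1) * (cosn j.+1 x + cosn j x))).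
have cg' k i := continuousZ_fun k (cint i).
have cgB : continuous (fun x => (c + j.+1%:R) * (vnorm x `^ (c - 1) * (cosn j.+2 x + cosn j.+1 x))
   - (c - j.+1%:R) * (vnorm x `^ (c - 1) * (cosn j.+1 x + cosn j x))).
  by move=> x; apply: cvgB; [exact: (cg' _ j.+1)|exact: (cg' _ j)].
have cg : continuous g by exact: (continuousZ_fun (2 * pi) cgB).
have pg : periodic1 g.
  by move=> x; rewrite /g !periodic1_cosn /vnorm periodic1_cos2pi.
pose G x := vnorm x `^ c * sin (2 * pi * j.+1%:R * x).
have cG : continuous G.
  apply: continuousM_fun => //.
  by apply: (@continuous_dilation R _ _ sin); exact: continuous_sin.
have pi0 := @pi_gt0 R.
have vpos x : - 2^-1 < x < 2^-1 -> 0 < vnorm x.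
  move=> /andP[xl xr].
  have : -1 < cos (2 * pi * x).
    rewrite -cospi -(cos_norm (2 * pi * x)) ltr_cos ?in_itv/= ?lexx ?(ltW pi0)//.
      rewrite normrM gtr0_norm ?mulr_gt0//.
      have : `|x| < 2^-1 by rewrite ltr_norml xl.
      by nra.
    rewrite normr_ge0/= normrM gtr0_norm ?mulr_gt0//.
    have : `|x| < 2^-1 by rewrite ltr_norml xl.
    by nra.
  by rewrite /vnorm; lra.
have dG x : - 2^-1 < x < 2^-1 -> is_derive x 1 G (g x).
  move=> /vpos vx.
  have := @is_derive_vnorm_powR_sin c j.+1 x vx; rewrite -/G.
  congr (is_derive _ _ _ _); rewrite /g; congr (_ * _).
  (* The addition formulas turn vnorm * cosn (j + 1) into 2 cosn (j + 1) + cosn (j + 2) + cosn j,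
     and the product of sines into half of cosn j - cosn (j + 2); regrouping gives the integrands of
     the two moments. *)
  have cp : cosn j.+2 x = cos (2 * pi * j.+1%:R * x) * cos (2 * pi * x) -
      sin (2 * pi * j.+1%:R * x) * sin (2 * pi * x).
    by rewrite /cosn -cosD -[j.+2%:R]natr1; congr cos; ring.
  have cm : cosn j x = cos (2 * pi * j.+1%:R * x) * cos (2 * pi * x) +
      sin (2 * pi * j.+1%:R * x) * sin (2 * pi * x).
    by rewrite /cosn -cosB -[j.+1%:R]natr1; congr cos; ring.
  rewrite -(@mulr_powRB1 _ _ c) ?vnorm_ge0//; last by lra.
  rewrite cp cm {1}/vnorm /cosn; ring.
have vend : vnorm 2^-1 = 0 /\ vnorm (- 2^-1) = 0.
  rewrite /vnorm mulrN cosN (_ : 2 * pi / 2 = pi :> R); last by field.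
  by rewrite cospi; split; ring.
have ig : integ (- 2^-1) (2^-1) g = 0.
  rewrite /integ /Rintegral (@continuous_FTC2 R g G).
  - have cn0 : c != 0 by rewrite gt_eqF//; lra.
    by rewrite /G vend.1 vend.2 powR0// !mul0r /= subrr.
  - by rewrite lt_neqAle; apply/andP; split; [apply/eqP; lra|lra].
  - exact: continuous_subspaceT.
  - split.
    + by move=> x; rewrite in_itv/= => /dG[].
    + by apply: cvg_at_right_filter; exact: cG.
    + by apply: cvg_at_left_filter; exact: cG.
  - by move=> x; rewrite in_itv/= => /dG dx; rewrite derive1E; exact: derive_val.
have := integ_period (- 2^-1) cg pg.
have -> : - 2^-1 + 1 = 2^-1 :> R by field.
rewrite ig /g integZ// integB; [|exact: (cg' _ j.+1)|exact: (cg' _ j)].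
rewrite !integZ// -/(moment c j.+1) -/(moment c j) => /esym/eqP.
rewrite mulf_eq0 gt_eqF/= ?mulr_gt0// subr_eq0 => /eqP.
by [].
Qed.

(** Since cosn 1 + cosn 0 = vnorm / 2, this moment is half the integral of vnorm^c, which
    Bernoulli's inequality bounds below by 1 + c. *)
Lemma moment0_gt0 c : 1 < c -> 0 < moment c 0.
Proof.
move=> c1.
have cv : continuous (fun x => vnorm x `^ c).
  by apply: continuous_powR_comp; [lra|exact: continuous_vnorm|exact: vnorm_ge0].
have -> : moment c 0 = 2^-1 * integ 0 1 (fun x => vnorm x `^ c).
  rewrite -integZ//; apply: eq_integ => x.
  rewrite -(@mulr_powRB1 _ _ c) ?vnorm_ge0//; last by lra.
  by rewrite /cosn mulr0 mul0r cos0 mulr1 {2}/vnorm; field.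
rewrite mulr_gt0//.
apply: (@lt_le_trans _ _ (integ 0 1 (fun x => (1 + c) + (2 * c) * cos (2 * pi * x)))).
  rewrite integD//; last exact: (continuousZ_fun (2 * c) continuous_cos2pi).
  rewrite integ_cst// integZ; last exact: continuous_cos2pi.
  by rewrite integ_cos2pi; lra.
apply: le_integ => //.
  move=> x; apply: cvgD; first exact: continuous_const.
  exact: (continuousZ_fun (2 * c) continuous_cos2pi).
move=> x _; apply: le_trans (powR_bernoulli_ge (ltW c1) (vnorm_ge0 x)).
by rewrite /vnorm; lra.
Qed.

(** In [moment_rec] the factor c - (j + 1) is positive as long as j + 1 <= k, where k is the integer
    part of [c] and [c] is not an integer. It first becomes negative at j = k, which flips the
    sign. *)
Lemma moment_lt0 c : 1 < c -> (forall n : nat, c != n%:R) ->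
  exists j, moment c j < 0.
Proof.
move=> c1 cn; pose k := Num.truncn c.
have kc : k%:R <= c by rewrite truncn_le//; lra.
have ck : c < k.+1%:R by exact: truncnS_gt.
have pos j : (j <= k)%N -> 0 < moment c j.
  elim: j => [_|j IH jk]; first exact: moment0_gt0.
  have jc : j.+1%:R < c.
    by rewrite lt_neqAle eq_sym cn/= (le_trans _ kc)// ler_nat.
  have cj : 0 < c + j.+1%:R by apply: addr_gt0; [lra|exact: ltr0Sn].
  rewrite -(pmulr_rgt0 _ cj) moment_rec// mulr_gt0 ?subr_gt0//.
  exact/IH/ltnW.
exists k.+1.
have ck0 : 0 < c + k.+1%:R by apply: addr_gt0; [lra|exact: ltr0Sn].
by rewrite -(pmulr_rlt0 _ ck0) moment_rec// pmulr_llt0 ?subr_lt0// pos.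
Qed.

End above_two.

(** * Perturbation of 1 + e_1, and exponents [q] near [p] *)

Section majorant_failure.
Context {R : realType}.
Implicit Types (p q c s x y : R).

(* Take [D] and [S] equal to [1 + e_1 + s e_(j+1)] and [1 + e_1 - s e_(j+1)]
   with [s] small and [moment (p / 2) j < 0]. *)
Lemma majorant_failure p : 2 < p -> (forall n : nat, p != (2 * n)%:R) ->
  exists (S D : R -> R[i]), [/\ majorant S D, forall x, normc (S x) <= 3 &
    integ 0 1 (fun x => normc (D x) `^ p) < integ 0 1 (fun x => normc (S x) `^ p)].
Proof.
move=> p2 pn; pose c := p / 2.
have c1 : 1 < c by rewrite /c; lra.
have cn (n : nat) : c != n%:R.
  apply/eqP => cE; have /eqP := pn n; apply.
  by rewrite natrM -cE /c; field.
have [j Bj] := moment_lt0 c1 cn.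
pose b x : R := cosn j.+1 x + cosn j x.
have cb : continuous b by move=> x; apply: cvgD; exact: continuous_cosn.
have cosn1 i x : -1 <= cosn i x <= 1 by rewrite cos_geN1 cos_le1.
have b2 x : -2 <= b x <= 2.
  by rewrite /b; have := cosn1 j x; have := cosn1 j.+1 x; lra.
have c10 : 0 < c - 1 by lra.
(* As |b| <= 2, an error of - moment / 4 in the weight changes the integral by at most - moment / 2,
   so half of the negative moment remains. *)
have eta0 : 0 < - moment c j / 4 by lra.
have [d d0 dP] := @segment_unif_continuous R _ 0 9 _ (continuous_normr_powR c10) eta0.
(* For s <= 1 the squared modulus moves by at most |2 s b + s^2| <= 5 s. *)
have [s [s0 s1 sd]] : exists s : R, [/\ 0 < s, s <= 1 & 5 * s < d].
  exists (Num.min 1 (d / 6)); split.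
  - by rewrite lt_min ltr01/= divr_gt0.
  - by rewrite ge_min lexx.
  - have : Num.min 1 (d / 6) <= d / 6 by rewrite ge_min lexx orbT.
    by lra.
pose D x : R[i] := 1 + (ek 1 x + s%:C * ek j.+1%:Z x).
pose S x : R[i] := 1 + (ek 1 x - s%:C * ek j.+1%:Z x).
have mSD : majorant S D.
  have s20 : 0 <= 2 * s by lra.
  split.
  - apply: eq_posdef (posdefD (posdef_cst (ler0n R 2)) (posdef_ek 1 (ler0n R 2))) => x.
    by rewrite /S /D !rmorph_nat; ring.
  - apply: eq_posdef (posdef_ek j.+1%:Z s20) => x.
    by rewrite /S /D rmorphM !rmorph_nat; ring.
(* The squared modulus of 1 + e_1 + e e_(j+1); [b] is the real part of the cross term. *)
pose X (e : R) x := vnorm x + 2 * e * b x + e ^+ 2.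
have XE (e : R) x : (1 + (cos (2 * pi * x) + e * cosn j.+1 x)) ^+ 2 +
    (sin (2 * pi * x) + e * sin (2 * pi * j.+1%:R * x)) ^+ 2 = X e x.
  have -> : X e x = 1 + 2 * cos (2 * pi * x) + (cos (2 * pi * x) ^+ 2 + sin (2 * pi * x) ^+ 2)
      + 2 * e * b x + e ^+ 2 * (cos (2 * pi * j.+1%:R * x) ^+ 2 + sin (2 * pi * j.+1%:R * x) ^+ 2).
    by rewrite !cos2Dsin2 /X /vnorm; ring.
  have cm : cosn j x = cos (2 * pi * j.+1%:R * x) * cos (2 * pi * x) +
      sin (2 * pi * j.+1%:R * x) * sin (2 * pi * x).
    by rewrite /cosn -cosB -[j.+1%:R]natr1; congr cos; ring.
  by rewrite /b cm /cosn; ring.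
have X0 e x : 0 <= X e x by rewrite -XE addr_ge0 ?sqr_ge0.
have sqrt_p t : 0 <= t -> Num.sqrt t `^ p = t `^ c.
  by move=> t0; rewrite -powR12_sqrt// -powRrM /c mulrC.
have nD x : normc (D x) `^ p = X s x `^ c.
  rewrite normcE_ReIm -sqrt_p//; congr (Num.sqrt _ `^ p).
  rewrite -XE /D /ek /cosn /= -pmulrn mulr1.
  by ring.
have nS x : normc (S x) `^ p = X (- s) x `^ c.
  rewrite normcE_ReIm -sqrt_p//; congr (Num.sqrt _ `^ p).
  rewrite -XE /S /ek /cosn /= -pmulrn mulr1.
  by ring.
exists S, D; split => //.
  have nek k x : normc (ek k x) = 1 by rewrite normcE_ReIm cos2Dsin2 sqrtr1.
  move=> x; apply: le_trans (normc_leD _ _) _; rewrite normc1.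
  apply: (@le_trans _ _ (1 + (1 + s))); last by lra.
  rewrite lerD2l; apply: le_trans (normc_leD _ _) _; rewrite nek lerD2l.
  by rewrite normcN normcM nek mulr1 normc_real gtr0_norm.
rewrite (eq_integ 0 1 nD) (eq_integ 0 1 nS).
have cX e : continuous (X e).
  move=> x; apply: cvgD; last exact: continuous_const.
  apply: cvgD; first exact: continuous_vnorm.
  exact: (continuousZ_fun (2 * e) cb).
have cXp e k : 0 < k -> continuous (fun x => X e x `^ k).
  by move=> k0; exact: continuous_powR_comp.
have cw : continuous (fun x => vnorm x `^ (c - 1)).
  by apply: continuous_powR_comp; [|exact: continuous_vnorm|exact: vnorm_ge0].
have cwb := continuousM_fun cw cb.
have cc0 : 0 < c by lra.
rewrite -subr_lt0 -integB; [|exact: cXp|exact: cXp].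
pose k := 4 * c * s.
have k0 : 0 < k by apply: mulr_gt0 => //; exact: mulr_gt0.
have cu : continuous (fun x => vnorm x `^ (c - 1) * b x + (- moment c j / 4) * 2).
  by move=> x; apply: cvgD; [exact: cwb|exact: continuous_const].
apply: (@le_lt_trans _ _ (integ 0 1 (fun x => k *
    (vnorm x `^ (c - 1) * b x + (- moment c j / 4) * 2)))).
  apply: le_integ.
  - by move=> x; apply: cvgB; exact: cXp.
  - exact: (continuousZ_fun k cu).
  (* X s - X (- s) = 4 s b exactly. The tangent is taken at X s, and uniform continuity then
     replaces the weight there by that of [vnorm]. *)
  move=> x _; apply: le_trans (powR_subl_le c1 (X0 s x) (X0 (- s) x)) _.
  have -> : c * X s x `^ (c - 1) * (X s x - X (- s) x) = k * (X s x `^ (c - 1) * b x).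
    by rewrite /k; set u := _ `^ _; rewrite /X; ring.
  rewrite ler_pM2l// -lerBlDl -mulrBl.
  have vx9 : 0 <= vnorm x <= 9.
    by rewrite vnorm_ge0/= /vnorm; have := cos_le1 (2 * pi * x); lra.
  have vX : `|vnorm x - X s x| < d.
    apply: le_lt_trans sd; rewrite /X ler_norml.
    by have := b2 x; nra.
  have := dP (vnorm x) (X s x) vx9 vX.
  rewrite (ger0_norm (vnorm_ge0 x)) (ger0_norm (X0 s x)) distrC => hd.
  apply: le_trans (ler_norm _) _; rewrite normrM.
  apply: ler_pM => //; first exact: ltW.
  by rewrite ler_norml.
rewrite integZ// integD// integ_cst// -/(moment c j).
by rewrite pmulr_rlt0//; lra.
Qed.

(** The strict inequality at q = p persists just below [p], because |S| <= 3 gives |S|^q >= 3^(q-p)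
    |S|^p. *)
Lemma concentration_near p : 2 < p -> (forall n : nat, p != (2 * n)%:R) ->
  exists qp : R, qp < p /\
    (forall q, 0 < q -> qp < q -> q < p -> concentration p q).
Proof.
move=> p2 pn; have p0 : 0 < p by lra.
have [S [D [mSD SB DS]]] := majorant_failure p2 pn.
have [rS rD] := regular_majorant mSD.
have [al alE] : {c : R | c = integ 0 1 (fun x => normc (D x) `^ p)} by eexists.
have [sg sgE] : {c : R | c = integ 0 1 (fun x => normc (S x) `^ p)} by eexists.
rewrite -alE -sgE in DS.
have al0 : 0 <= al by rewrite alE; apply: integ_ge0 => x; exact: powR_ge0.
(* Unlike [al], this number is surely positive, so its powers are exponentials, continuous in the
   exponent; moreover h p = sg - m > 0. *)
pose m := (al + sg) / 2.
have alm : al < m by rewrite /m; lra.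
have msg : m < sg by rewrite /m; lra.
have m0 : 0 < m by lra.
pose h q := expR ((q - p) * ln 3) * sg - expR (q * (p^-1 * ln m)).
have ch : continuous h.
  have ce (u : R -> R) : continuous u -> continuous (fun q => expR (u q)).
    by move=> cu x; apply: continuous_comp; [exact: cu|exact: continuous_expR].
  have cid : continuous (@id R) by move=> x; exact: cvg_id.
  have cB : continuous (fun q => q - p).
    by move=> x; apply: cvgB; [exact: cid|exact: continuous_const].
  have ce1 := ce _ (continuousM_fun cB (continuous_const (ln 3))).
  have ch1 := continuousM_fun ce1 (continuous_const sg).
  have ch2 := ce _ (continuousM_fun cid (continuous_const (p^-1 * ln m))).
  by move=> q; apply: cvgB; [exact: ch1|exact: ch2].
have hp : 0 < h p.
  rewrite /h subrr mul0r expR0 mul1r mulVKf ?gt_eqF// lnK ?posrE//.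
  by rewrite subr_gt0.
have /cvgrPdist_lt/(_ _ hp)[r /= r0 rP] := ch p.
exists (p - r); split; first by rewrite ltrBlDr ltrDl.
move=> q q0 rq qp.
apply: (@concentration_of_majorant R p q S D 3) => //; first exact: ltW.
rewrite -alE.
have hq : 0 < h q.
  have : `|h p - h q| < h p.
    by apply: rP => /=; rewrite gtr0_norm ?subr_gt0//; lra.
  by rewrite ltr_norml; lra.
apply: (@le_lt_trans _ _ (expR (q * (p^-1 * ln m)))).
  have -> : expR (q * (p^-1 * ln m)) = m `^ (q / p).
    by rewrite /powR gt_eqF// mulrA.
  rewrite ge0_ler_powR ?nnegrE ?(ltW m0) ?(ltW alm)//.
  by rewrite divr_ge0 ?ltW.
apply: (@lt_le_trans _ _ (expR ((q - p) * ln 3) * sg)).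
  by move: hq; rewrite /h subr_gt0.
have e3 : expR ((q - p) * ln 3) = 3 `^ (q - p) by rewrite /powR gt_eqF.
rewrite e3 sgE -integZ; last exact: continuous_normc_powR.
apply: le_integ.
- by apply: continuousM_fun => //; exact: continuous_normc_powR.
- exact: continuous_normc_powR.
move=> x _.
have -> : p = (p - q) + q by ring.
rewrite (@powRD _ (normc (S x))); last by rewrite subrK gt_eqF.
rewrite mulrA ler_piMl ?powR_ge0//.
have -> : q - (p - q + q) = - (p - q) by ring.
rewrite powRN mulrC ler_pdivrMr ?powR_gt0// mul1r.
by rewrite ge0_ler_powR ?nnegrE ?normc_ge0 ?SB// subr_ge0 ltW.
Qed.

End majorant_failure.

Theorem theorem3 (R : realType) :
  (forall p q : R, 0 < q -> q <= p -> p < 2 -> concentration p q) /\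
  (forall p : R, 0 < p -> ~ (exists n : nat, p = (2 * n)%:R) ->
     exists qp : R, qp < p /\
       (forall q : R, 0 < q -> qp < q -> q < p -> concentration p q)).
Proof.
split; first by move=> p q; exact: concentration_lt2.
move=> p p0 pn.
have pn' (n : nat) : p != (2 * n)%:R by apply/eqP => pE; apply: pn; exists n.
have [p2|p2|pE] := ltgtP p 2.
- exists 0; split => // q q0 _ qp; apply: concentration_lt2 => //.
  exact: ltW.
- exact: concentration_near.
- by have := pn' 1%N; rewrite muln1 pE eqxx.
Qed.
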